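(* Under the assumption that, for all $n=1,2,\ldots$ and all $a_1,\ldots,a_n\in\alpha$, the limit $$\mathsf S_{a_1,\ldots,a_n} := \lim_{\ell\to\infty} \ell^{n-1}\langle\!\langle q_{a_1},\cdots , q_{a_n}\rangle\!\rangle^{\rm c}_\ell$$ exists, the following holds for every $n=1,2,\ldots$ and all $o_1,\ldots,o_n,o\in\mathcal A$: the limits $$\mathsf S_{o_1,\ldots,o_n} := \lim_{\ell\to\infty} \ell^{n-1}\langle\!\langle \mathsf o_1(\underline q),\cdots ,\mathsf o_n(\underline q)\rangle\!\rangle^{\rm c}_\ell,\qquad \langle\!\langle \mathsf o(\underline q)\rangle\!\rangle := \lim_{\ell\to\infty} \langle\!\langle \mathsf o(\underline q)\rangle\!\rangle_\ell$$ exist; we have $$\langle\!\langle \mathsf o(\underline q)\rangle\!\rangle = \mathsf o(\langle\!\langle \underline q\rangle\!\rangle);$$ and, for all $n\geq 2$, $$\mathsf S_{o_1,\ldots,o_n}= \sum_{\Upsilon\in C^{\rm min}(n)}\ \sum_{a_k^V\in \alpha\,:\,k\in V,V\in\Upsilon} \Bigg(\prod_{\{k_1,\ldots,k_{|V|}\}=V\in\Upsilon} \mathsf S_{a^V_{k_1},\ldots,a^V_{k_{|V|}}}\Bigg)\times\Bigg(\prod_{k=1}^n \frac{\partial^{m_\Upsilon(k)}\mathsf o_k(\underline{\mathsf q})}{\prod_{V\in\Upsilon_k}\partial \mathsf q_{a^V_k}}\Bigg|_{\underline{\mathsf q} = \langle\!\langle \underline{q}\rangle\!\rangle}\Bigg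).$$
   Context: Let $\alpha$ be a set and $\mathcal A$ a unital, commutative, associative algebra over $\mathbb F=\mathbb R$ or $\mathbb C$ generated by $\{\mathbf 1, q_a : a\in\alpha\}$. Write $\underline q=(q_a:a\in\alpha)$; every element $o\in\mathcal A$ is a polynomial $o=\mathsf o(\underline q)=c\mathbf 1+\sum_{n\ge1}\sum_{a_1,\ldots,a_n\in\alpha}c^{a_1,\ldots,a_n}q_{a_1}\cdots q_{a_n}$ with finitely many nonzero coefficients. Let $\langle\!\langle\cdot\rangle\!\rangle_\ell:\mathcal A\to\mathbb F$, $\ell>0$, be a family of linear maps normalised by $\langle\!\langle\mathbf 1\rangle\!\rangle_\ell=1$, and define the cumulants $\langle\!\langle\cdot,\ldots,\cdot\rangle\!\rangle^{\rm c}_\ell$ via the moment–cumulant formula $\langle\!\langle o_1\cdots o_n\rangle\!\rangle_\ell=\sum_{\Pi\in P(n)}\prod_{V=(j_1,\ldots,j_{|V|})\in\Pi}\langle\!\langle o_{j_1},\ldots,o_{j_{|V|}}\rangle\!\rangle^{\rm c}_\ell$, with $P(n)$ the set of partitions of $\{1,\ldots,n\}$. A connected cover of $\{1,\ldots,n\}$ is a set $\Upsilon$ of patches $V\subseteq\{1,\ldots,n\}$ whose union is $\{1,\ldots,n\}$ and such that no subset of patches has union disjoint from the union of the complementary patches. Its index is $\iota(\Upsilon)=\sum_{V\in\Upsilon}|V|-|\Upsilon|$ (minimal value $n-1$). $C^{\rm min}(n)$ is the set of connected covers with $\iota(\Upsilon)=n-1$ and $|V|\ge2$ for all $V\in\Upsilon$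 (minimal connected covers). For $k\in\{1,\ldots,n\}$, $\Upsilon_k=\{V\in\Upsilon:k\in V\}$ and $m_\Upsilon(k)=|\Upsilon_k|$. For each $V\in\Upsilon$ and $k\in V$, $a^V_k\in\alpha$ is an independent summation index. $\langle\!\langle\underline q\rangle\!\rangle=(\lim_{\ell\to\infty}\langle\!\langle q_a\rangle\!\rangle_\ell: a\in\alpha)$. *)

(* Defs.v *)
From HB Require Import structures.
From mathcomp Require Import all_boot all_order all_algebra.
From mathcomp Require Import boolp classical_sets fsbigop topology normedtype.
Set Implicit Arguments.
Unset Strict Implicit.
Unset Printing Implicit Defensive.
Import Order.TTheory GRing.Theory Num.Theory.
Local Open Scope ring_scope.

(* A polynomial in the commuting variables q_a (a : alpha), written as in the
   paper as a finite formal sum  sum_t c_t q_{a_1} ... q_{a_m}  of terms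
   (c_t, [:: a_1; ...; a_m]); the empty word is the constant term c 1. *)
Definition qpolynom (F alpha : Type) := seq (F * seq alpha).

Definition evalA (F : numFieldType) (A : lalgType F) (alpha : Type)
  (q : alpha -> A) (P : qpolynom F alpha) : A :=
  \sum_(t <- P) t.1 *: \prod_(a <- t.2) q a.

Definition evalF (F : numFieldType) (alpha : Type)
  (x : alpha -> F) (P : qpolynom F alpha) : F :=
  \sum_(t <- P) t.1 * \prod_(a <- t.2) x a.

Definition drop_at (T : Type) (i : nat) (s : seq T) := take i s ++ drop i.+1 s.

Definition pderiv (F : Type) (alpha : eqType) (b : alpha) (P : qpolynom F alpha)
  : qpolynom F alpha :=
  flatten [seq [seq (t.1, drop_at i t.2) | i <- iota 0 (size t.2)
                 & nth b t.2 i == b] | t <- P].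

Definition pderivs (F : Type) (alpha : eqType) (bs : seq alpha)
  (P : qpolynom F alpha) : qpolynom F alpha := foldr (@pderiv F alpha) P bs.

(* Moment-cumulant formula: kappa l [:: o_1; ...; o_n] is the cumulant
   <<o_1,...,o_n>>^c_l, the blocks V = {j_1 < ... < j_|V|} being listed in
   increasing order. *)
Definition moment_cumulant (F : numFieldType) (A : comAlgType F)
  (mom : F -> A -> F) (kappa : F -> seq A -> F) : Prop :=
  forall l : F, 0 < l -> forall s : seq A, (0 < size s)%N ->
    mom l (\prod_(o <- s) o) =
    \sum_(P : {set {set 'I_(size s)}} | finset.partition P [set: 'I_(size s)])
      \prod_(V | V \in P) kappa l [seq nth 0 s (val j) | j <- enum V].

Definition scaled_cum (F : numFieldType) (A : comAlgType F)
  (kappa : F -> seq A -> F) (s : seq A) (l : F) : F :=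
  l ^+ (size s).-1 * kappa l s.

Definition connected_cover (n : nat) (U : {set {set 'I_n}}) : bool :=
  (finset.cover U == [set: 'I_n]) &&
  [forall S : {set {set 'I_n}},
     [&& S \subset U, S != finset.set0 & S != U] ==>
     ~~ [disjoint finset.cover S & finset.cover (U :\: S)]].

Definition cover_index (n : nat) (U : {set {set 'I_n}}) : int :=
  (\sum_(V | V \in U) #|V|)%:Z - #|U|%:Z.

Definition min_cover (n : nat) (U : {set {set 'I_n}}) : bool :=
  [&& connected_cover U, cover_index U == (n%:Z - 1) & [forall V in U, 1 < #|V|]%N].

(* Families (a^V_k : V in U, k in V) of elements of alpha, encoded as the
   finite functions a on pairs (V,k) with a (V,k) = Some a^V_k exactly when
   V \in U and k \in V, and None otherwise. *)
Definition index_families (alpha : choiceType) (n : nat) (U : {set {set 'I_n}})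
  : set {ffun {set 'I_n} * 'I_n -> option alpha} :=
  [set a | forall p : {set 'I_n} * 'I_n,
     (a p != None) = (p.1 \in U) && (p.2 \in p.1)].

Definition block_indices (alpha : Type) (n : nat)
  (a : {set 'I_n} * 'I_n -> option alpha) (V : {set 'I_n}) : seq alpha :=
  pmap (fun k => a (V, k)) (enum V).

Definition point_indices (alpha : Type) (n : nat)
  (a : {set 'I_n} * 'I_n -> option alpha) (U : {set {set 'I_n}}) (k : 'I_n)
  : seq alpha :=
  pmap (fun V => a (V, k)) (enum U).

(* Main.v *)
(* In the limit the term <<o',o'',o_2,...>> of the product rule
     <<o'o'',o_2,...,o_n>> = <<o',o'',o_2,...,o_n>> + sum_{I,J} <<o',o_I>> <<o'',o_J>>,
   where I and J partition {2,...,n}, is suppressed by a factor 1/l, so the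
   limits S obey the Leibniz rule S(o'o'',s) = sum_{I,J} S(o',o_I) S(o'',o_J).
   Together with multilinearity, symmetry and the values on the generators this
   rule determines S. Minimal connected covers are hypertrees, and cutting a
   hypertree at one of its vertices shows that the sum over labelled hypertrees
   obeys the same rule. *)

Require Import Defs.
From mathcomp Require Import all_boot all_order all_algebra.
From mathcomp Require Import ring zify.
Set Implicit Arguments.
Unset Strict Implicit.
Unset Printing Implicit Defensive.
Import Order.TTheory GRing.Theory Num.Theory.
Local Open Scope ring_scope.

(** * Convolution of functions on words *)

(** The moment-cumulant formula states neither symmetry nor linearity nor a product rule for the
    cumulants. Sorting partitions by the block of the first entry turns it into a convolution on
    words: the moment [M (x :: t)] is [kappa (x :: _)] convolved with [M]. Since [M [::] = 1],
    convolution with [M] is injective, so each law of cumulants reduces to an identity of moments.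
    On the tree side each vertex carries the iterated derivatives of its polynomial at [qbar], as a
    function of the word of labels on its edges. For a monomial with first letter b this function is
    again a convolution, whose first factor receives no edge or one edge; that edge is where the
    tree is cut. Both sides thus obey one recursion, and it lowers the surplus, the sum of length
    minus 1 over the words. Hypertree sums are taken over a finite type of labels, whereas [alpha]
    may be infinite. Derivatives by absent letters vanish, so the letters of the given polynomials
    suffice. *)

(* The sum of F u * G v over all ways to deal the letters of s out into two
   subsequences u and v. *)
Fixpoint conv (T : Type) (R : comPzRingType) (F G : seq T -> R) (s : seq T) : R :=
  if s is y :: s' then conv (fun u => F (y :: u)) G s' + conv F (fun u => G (y :: u)) s'
  else F [::] * G [::].

Definition nil_indicator (T : Type) (R : comPzRingType) (s : seq T) : R := (nilp s)%:R.

Section Convolution.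
Variables (T : Type) (R : comPzRingType).
Implicit Types (F G H M : seq T -> R) (s t : seq T).

Lemma conv_ext F F' G G' s :
  (forall t, (size t <= size s)%N -> F t = F' t) ->
  (forall t, (size t <= size s)%N -> G t = G' t) ->
  conv F G s = conv F' G' s.
Proof.
elim: s F F' G G' => [|y s IH] F F' G G' eF eG /=; first by rewrite eF // eG.
congr (_ + _); apply: IH => t ts; by [apply: eF; rewrite /= ltnW|apply: eG; rewrite /= ltnW
  |apply: eF|apply: eG].
Qed.

Lemma eq_conv F F' G G' : F =1 F' -> G =1 G' -> conv F G =1 conv F' G'.
Proof. by move=> eF eG s; apply: conv_ext => t _. Qed.

Lemma convC F G s : conv F G s = conv G F s.
Proof.
elim: s F G => [|y s IH] F G /=; first exact: mulrC.
by rewrite addrC; congr (_ + _); apply: IH.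
Qed.

Lemma convDl F F' G s : conv (fun t => F t + F' t) G s = conv F G s + conv F' G s.
Proof.
elim: s F F' G => [|y s IH] F F' G /=; first exact: mulrDl.
by rewrite !IH; ring.
Qed.

Lemma convZl c F G s : conv (fun t => c * F t) G s = c * conv F G s.
Proof.
elim: s F G => [|y s IH] F G /=; first by rewrite mulrA.
by rewrite !IH; ring.
Qed.

Lemma convDr F G G' s : conv F (fun t => G t + G' t) s = conv F G s + conv F G' s.
Proof. by rewrite convC convDl !(convC _ F). Qed.

Lemma convA F G H s : conv F (conv G H) s = conv (conv F G) H s.
Proof.
elim: s F G H => [|y s IH] F G H /=; first exact: mulrA.
by rewrite convDr convDl !IH; ring.
Qed.

Lemma conv0 G s : conv (fun=> 0) G s = 0.
Proof. by elim: s G => [|y s IH] G /=; rewrite ?mul0r // !IH addr0. Qed.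

Lemma conv1 G s : conv (@nil_indicator T R) G s = G s.
Proof.
elim: s G => [|y s IH] G /=; first by rewrite /nil_indicator /= mul1r.
by rewrite IH (_ : conv _ _ _ = 0) ?add0r //; apply: conv0.
Qed.

(** Convolution is triangular in the length: only the deal that gives all of [s] to the first factor
    sees [F] at full length, and there the other factor is [M [::]]. *)
Lemma conv_top F F' M s :
  (forall t, (size t < size s)%N -> F t = F' t) ->
  conv F M s - conv F' M s = (F s - F' s) * M [::].
Proof.
elim: s F F' M => [|y s IH] F F' M eF /=; first by rewrite mulrBl.
rewrite (conv_ext (F := F) (F' := F') (G' := fun u => M (y :: u))) //.
rewrite -(IH (fun u => F (y :: u)) (fun u => F' (y :: u))); first by ring.
by move=> t lt; apply: eF.
Qed.

(** With [M] the moments, this is how laws of cumulants are proved: an identity is checked after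
    convolution and then divided out by induction on the length. *)
Lemma conv_cancel F F' M :
  M [::] = 1 -> conv F M =1 conv F' M -> F =1 F'.
Proof.
move=> M1 eFM s; have [n] := ubnP (size s); elim: n s => // n IH s sn.
have /(conv_top M): forall t, (size t < size s)%N -> F t = F' t.
  by move=> t ts; apply: IH; apply: leq_trans ts _; rewrite -ltnS.
by rewrite eFM subrr M1 mulr1 => /esym/eqP; rewrite subr_eq0 => /eqP.
Qed.

Definition swap_invariant F :=
  forall p y z s, F (p ++ y :: z :: s) = F (p ++ z :: y :: s).

(** Deals that separate [y] from [z] correspond to each other, those that send both to [M] agree by
    symmetry of [M], and those that send both to [F] agree by hypothesis unless [F] receives the
    whole word. *)
Lemma conv_swap F M p y z s :
  swap_invariant M ->
  (forall p' y' z' s', (size p' + size s' < size p + size s)%N ->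
     F (p' ++ y' :: z' :: s') = F (p' ++ z' :: y' :: s')) ->
  conv F M (p ++ y :: z :: s) - conv F M (p ++ z :: y :: s) =
  (F (p ++ y :: z :: s) - F (p ++ z :: y :: s)) * M [::].
Proof.
elim: p F M => [|x p IH] F M symM symF /=.
  rewrite -(@conv_top (fun u => F (y :: z :: u)) (fun u => F (z :: y :: u))); last first.
    by move=> t ts; apply: (symF [::] y z t); rewrite /= add0n.
  rewrite [conv F (fun u => M (z :: y :: u)) s](@conv_ext _ F _ (fun u => M (y :: z :: u))) //.
    by ring.
  by move=> t _; apply: (symM [::]).
rewrite (_ : forall a b c d : R, (a + b) - (c + d) = (a - c) + (b - d)); last by move=> *; ring.
rewrite IH //; last by move=> p' y' z' s' lt; apply: (symF (x :: p')); rewrite /= addSn ltnS.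
rewrite (_ : conv F _ _ - _ = 0) ?addr0 //.
rewrite IH //; last first.
- move=> p' y' z' s' lt; apply: symF.
  by rewrite addSn; apply: ltnW.
- by move=> p' y' z' s'; apply: (symM (x :: p')).
by rewrite symF ?subrr ?mul0r // /= addSn.
Qed.

Lemma conv_cancel_swap F M :
  M [::] = 1 -> swap_invariant M -> swap_invariant (conv F M) -> swap_invariant F.
Proof.
move=> M1 symM symFM p y z s; have [n] := ubnP (size p + size s).
elim: n p y z s => // n IH p y z s lt.
have := @conv_swap F M p y z s symM.
rewrite symFM subrr M1 mulr1 => H; apply/eqP; rewrite -subr_eq0 -H //.
by move=> p' y' z' s' lt'; apply: IH; apply: leq_trans lt' _; rewrite -ltnS.
Qed.

End Convolution.

Lemma conv_rcons (T : Type) (R : comPzRingType) (F G : seq T -> R) (s : seq T) y :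
  conv F G (rcons s y) =
  conv (fun u => F (rcons u y)) G s + conv F (fun u => G (rcons u y)) s.
Proof. by elim: s F G => //= z s IH F G; rewrite !IH; ring. Qed.

Lemma conv_map (T T' : Type) (R : comPzRingType) (f : T -> T') (F G : seq T' -> R) s :
  conv F G (map f s) = conv (fun u => F (map f u)) (fun u => G (map f u)) s.
Proof. by elim: s F G => //= y s IH F G; rewrite !IH. Qed.

(** The two lengths in a deal add up to [size s], so the powers of [l] factor out exactly. *)
Lemma conv_expr (T : Type) (R : comPzRingType) (l : R) (F G : seq T -> R) s :
  conv (fun u => l ^+ size u * F u) (fun u => l ^+ size u * G u) s =
  l ^+ size s * conv F G s.
Proof.
elim: s F G => [|y s IH] F G /=; first by rewrite expr0; ring.
have e (H : seq T -> R) : (fun u => l ^+ (size u).+1 * H (y :: u)) =1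
           (fun u => l ^+ size u * (l * H (y :: u))) by move=> u; rewrite exprS; ring.
rewrite (eq_conv (e F) (frefl _)) (eq_conv (frefl _) (e G)) !IH.
by rewrite convZl (convC F) convZl (convC _ F) exprS; ring.
Qed.

Lemma swap_invariant_perm (T : eqType) (R : comPzRingType) (F : seq T -> R) :
  swap_invariant F -> forall s t, perm_eq s t -> F s = F t.
Proof.
move=> symF.
have move_front p x s : F (p ++ x :: s) = F (x :: p ++ s).
  elim/last_ind: p s => [|p y IH] s //.
  by rewrite !cat_rcons symF IH.
suff H p s t : perm_eq s t -> F (p ++ s) = F (p ++ t) by move=> s t /(H [::]).
elim: s p t => [|x s IH] p t; first by move=> /perm_size /esym/size0nil ->.
move=> st; have xt: x \in t by rewrite -(perm_mem st) mem_head.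
case/splitPr: xt st => t1 t2 st.
have st' : perm_eq s (t1 ++ t2).
  by rewrite -(perm_cons x) (perm_trans st) // -cat1s perm_catCA.
have := IH (rcons p x) _ st'; rewrite !cat_rcons => ->.
by rewrite move_front [in RHS]catA move_front catA.
Qed.

(** For distinct positions a deal is the subset [B] sent to the first factor; this is the bridge
    between words and the subsets that occur in partitions and trees. *)
Lemma conv_set (X : finType) (T : Type) (R : comPzRingType) (f : X -> T)
    (F G : seq T -> R) (r : seq X) :
  uniq r ->
  conv F G (map f r) =
  \sum_(B : {set X} | B \subset r)
    F (map f [seq x <- r | x \in B]) * G (map f [seq x <- r | x \notin B]).
Proof.
elim: r F G => [|x r IH] F G /=.
  rewrite (big_pred1 set0) // => B /=; apply/subsetP/eqP => [H|-> y].
    by apply/setP => y; rewrite inE; apply/negP => /H.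
  by rewrite inE.
case/andP=> xr ur; rewrite !IH //.
rewrite [RHS](bigID (fun B : {set X} => x \in B)) /=.
have notx (B : {set X}) : B \subset r -> x \notin B.
  by move=> /subsetP Br; apply: contraNN xr => /Br.
congr (_ + _); last first.
- apply: eq_big => B.
    apply/idP/andP => [Br|[/subsetP Br xB]].
      split; last exact: notx.
      by apply/subsetP => y /(subsetP Br) yr; rewrite inE yr orbT.
    apply/subsetP => y yB; have := Br y yB; rewrite inE; case: eqP => // yx.
    by rewrite -yx yB in xB.
  by move=> /notx xB; rewrite (negbTE xB).
rewrite [RHS](reindex_onto (fun B => x |: B) (fun B => B :\ x)) /=; last first.
  by move=> B /andP[_]; exact: setD1K.
apply: eq_big => B.
  apply/idP/andP => [Br|[/andP[/subsetP Br _] /eqP BB]].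
    rewrite setU11 andbT setU1K ?notx // eqxx; split => //.
    by apply/subsetP => y; rewrite !inE => /predU1P[->|/(subsetP Br) ->];
      rewrite ?eqxx ?orbT.
  apply/subsetP => y; rewrite -BB !inE => /andP[yx].
  by rewrite (negbTE yx) /= => yB; have := Br y; rewrite !inE yB (negbTE yx) /=; apply.
move=> Br; rewrite setU11 /=; congr (F (_ :: map f _) * G (map f _));
  apply: eq_in_filter => y yr; rewrite !inE; case: eqP => // yx; by rewrite -yx yr in xr.
Qed.

(** * Sums over set partitions *)

Section PartitionSums.
Variables (R : comPzRingType).

Definition partition_sum (X : finType) (K : {set X} -> R) (D : {set X}) : R :=
  \sum_(P | partition P D) \prod_(V in P) K V.

Lemma partition_sum0 (X : finType) (K : {set X} -> R) : partition_sum K set0 = 1.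
Proof.
rewrite /partition_sum (big_pred1 set0) ?big_set0 // => P.
by rewrite partition_set0.
Qed.

(** Partitions are sorted by the block [B] that contains [i]; the other blocks form a partition of
    [D :\: B]. *)
Lemma partition_sum_rec (X : finType) (K : {set X} -> R) (D : {set X}) i :
  i \in D ->
  partition_sum K D =
  \sum_(B : {set X} | (B \subset D) && (i \in B)) K B * partition_sum K (D :\: B).
Proof.
move=> iD; rewrite /partition_sum.
rewrite (partition_big (fun P => pblock P i)
  (fun B => (B \subset D) && (i \in B))) /=; last first.
  move=> P partP; have iP : i \in cover P by rewrite (cover_partition partP).
  by rewrite mem_pblock iP andbT (partitionS partP) // pblock_mem.
apply: eq_bigr => B /andP[BD iB].
rewrite mulr_sumr.
rewrite (reindex_onto (fun P => B |: P) (fun P => P :\ B)) /=; last first.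
  move=> P /andP[partP /eqP <-]; rewrite setD1K // pblock_mem //.
  by rewrite (cover_partition partP).
have DBK : D :\: B :|: B = D.
  by rewrite setUC; apply/setP => x; rewrite !inE; case: (boolP (x \in B)) => // /(subsetP BD).
have B0 : B != set0 by apply/set0Pn; exists i.
have notB P : partition P (D :\: B) -> B \notin P.
  move=> partP; apply: contraL iB => /(partitionS partP)/subsetP H.
  by apply/negP => iB'; have := H _ iB'; rewrite inE iB'.
rewrite [in RHS](eq_bigr (fun P => \prod_(V in B |: P) K V)); last first.
  by move=> P partP; rewrite big_setU1 //= notB.
apply: eq_bigl => P.
apply/idP/idP => [/andP[/andP[partP _] /eqP PB]|partP].
  rewrite -PB; apply: partitionD1 => //; exact: setU11.
rewrite setU1K ?notB // eqxx andbT.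
have partBP : partition (B |: P) D.
  rewrite -DBK [D :\: B :|: B]setUC; apply: partitionU1 => //.
  by rewrite -setI_eq0 setIDA setDIl setDv set0I.
rewrite partBP /=; apply/eqP; apply: def_pblock => //; last exact: setU11.
exact: partition_trivIset partBP.
Qed.

Lemma partition_sum_imset (X Y : finType) (h : X -> Y) (K : {set Y} -> R) (D : {set X}) :
  injective h ->
  partition_sum K (h @: D) = partition_sum (fun V => K (h @: V)) D.
Proof.
move=> inj_h; have [n] := ubnP #|D|; elim: n D => // n IH D; rewrite ltnS => Dn.
have [->|[i iD]] := set_0Vmem D; first by rewrite imset0 !partition_sum0.
rewrite (partition_sum_rec _ iD) (partition_sum_rec K (imset_f h iD)).
rewrite (reindex_onto (fun B : {set X} => h @: B) (fun B => h @^-1: B)) /=; last first.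
  move=> B /andP[/subsetP BD _]; apply/setP => y; apply/imsetP/idP => [[x]|yB].
    by rewrite inE => ? ->.
  by have /imsetP[x xD yx] := BD _ yB; exists x; rewrite // inE -yx.
apply: eq_big => B.
  rewrite mem_imset // (_ : h @^-1: (h @: B) = B) ?eqxx ?andbT; last first.
    by apply/setP => x; rewrite inE mem_imset.
  congr (_ && _); apply/idP/idP => [/subsetP H|]; last exact: imsetS.
  by apply/subsetP => x xB; have := H _ (imset_f h xB); rewrite mem_imset.
move=> /andP[/andP[BD iB] _]; congr (_ * _).
have -> : h @: D :\: h @: B = h @: (D :\: B).
  apply/setP => y; apply/setDP/imsetP => [[/imsetP[x xD ->]]|[x /setDP[xD xB] ->]].
    by rewrite mem_imset // => xB; exists x => //; apply/setDP.
  by rewrite !mem_imset.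
rewrite IH //; apply: leq_trans Dn; apply: proper_card.
rewrite mem_imset // in iB.
apply/properP; split; first exact: subsetDl.
by exists i => //; rewrite inE iB.
Qed.

End PartitionSums.

(** * Algebra of cumulants *)

Section Cumulants.
Variables (F : numFieldType) (A : comAlgType F) (mom : A -> F) (kappa : seq A -> F).
Hypothesis mom_linear : forall c x y, mom (c *: x + y) = c * mom x + mom y.
Hypothesis mom1 : mom 1 = 1.

Definition listed (s : seq A) (V : {set 'I_(size s)}) : seq A :=
  [seq nth 0 s (val j) | j <- enum V].

Hypothesis mc : forall s : seq A, (0 < size s)%N ->
  mom (\prod_(o <- s) o) = partition_sum (fun V => kappa (listed V)) [set: 'I_(size s)].

Let M (s : seq A) : F := mom (\prod_(o <- s) o).

(** Removing the block of the first entry leaves a sublist, whereas the formula speaks of full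
    lists; positions in the sublist are sent back into [D] by an increasing map. *)
Lemma moment_subset (s : seq A) (D : {set 'I_(size s)}) :
  M (listed D) = partition_sum (fun V => kappa (listed V)) D.
Proof.
have [->|[i0 i0D]] := set_0Vmem D.
  by rewrite /M /listed enum_set0 big_nil partition_sum0.
rewrite /M; set s' := listed D.
have s's : size s' = #|D| by rewrite size_map -cardE.
rewrite mc; last by rewrite s's (cardD1 i0) i0D.
pose h (i : 'I_(size s')) := nth i0 (enum D) i.
have hlt (i : 'I_(size s')) : (i < size (enum D))%N by rewrite -cardE -s's.
have inj_h : injective h.
  move=> i j /eqP; rewrite /h nth_uniq ?enum_uniq // => /eqP; exact: val_inj.
have enumD : enum D = map h (enum 'I_(size s')).
  have -> : map h (enum 'I_(size s')) = map (nth i0 (enum D)) (map val (enum 'I_(size s'))).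
    by rewrite -map_comp.
  by rewrite val_enum_ord s's cardE map_nth_iota0 // take_size.
have {1}-> : D = h @: setT.
  apply/setP => x; rewrite -mem_enum enumD; apply/mapP/imsetP => [] [y _ ->];
    by exists y; rewrite // mem_enum.
rewrite partition_sum_imset //; apply: eq_bigr => P _; apply: eq_bigr => V _.
congr kappa; rewrite /listed.
(* As [h] is increasing, it sends the sorted listing of [V] to that of its image, so the arguments
   of [kappa] keep their order without any appeal to symmetry. *)
have -> : enum (h @: V) = map h (enum V).
  have -> : enum (h @: V) = [seq x <- enum D | x \in h @: V].
    rewrite /enum_mem -filter_predI; apply: eq_filter => x /=.
    case: imsetP => [[i _ ->]|]; rewrite ?andbF //=.
    by rewrite -mem_enum mem_nth.
  rewrite {1}enumD filter_map; congr map.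
  rewrite /enum_mem -filter_predI; apply: eq_filter => x /=.
  by rewrite mem_imset // andbT.
rewrite -map_comp; apply: eq_map => j /=.
by rewrite (nth_map i0) // -cardE -s's.
Qed.

(** The block of the head consists of [x] and one half of a deal of [t]; the remaining blocks resum
    to a moment by [moment_subset]. All laws of cumulants below rest on this recursion. *)
Lemma moment_cons (x : A) (t : seq A) :
  mom (x * \prod_(o <- t) o) = conv (fun u => kappa (x :: u)) M t.
Proof.
pose s := x :: t.
have -> : x * \prod_(o <- t) o = \prod_(o <- s) o by rewrite big_cons.
pose r := behead (enum 'I_(size s)).
have er : r = map (lift ord0) (enum 'I_(size t)) by rewrite /r enum_ordSl.
have es : enum 'I_(size s) = ord0 :: r by rewrite er enum_ordSl.
have [r0 ur] : ord0 \notin r /\ uniq r by apply/andP; rewrite -cons_uniq -es enum_uniq.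
have et : t = map (fun j : 'I_(size s) => nth 0 s j) r.
  rewrite er -map_comp /= -[LHS](mkseq_nth 0) /mkseq -val_enum_ord -map_comp.
  exact: eq_map.
rewrite {1}et conv_set // mc // (partition_sum_rec _ (in_setT ord0)).
rewrite (reindex_onto (fun B => ord0 |: B) (fun B => B :\ ord0)) /=; last first.
  by move=> B /andP[_]; exact: setD1K.
have Br (B : {set 'I_(size s)}) : (B \subset r) = (ord0 \notin B).
  apply/subsetP/idP => [H|B0 j jB]; first by apply: contra r0 => /H.
  have : j \in enum 'I_(size s) by rewrite mem_enum.
  by rewrite es inE => /predU1P[j0|//]; rewrite -j0 jB in B0.
apply: eq_big => B.
  rewrite subsetT setU11 Br /=; apply/eqP/idP => [<-|]; last exact: setU1K.
  by rewrite !inE eqxx.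
move=> /andP[_ /eqP BB]; have B0 : ord0 \notin B by rewrite -BB !inE eqxx.
rewrite -(@moment_subset s); congr (kappa _ * M _).
  rewrite /listed /enum_mem -enumT es /= setU11 /=; congr (_ :: map _ _).
  apply: eq_in_filter => j jr; rewrite !inE; case: eqP => // j0.
  by rewrite -j0 jr in r0.
rewrite /listed /enum_mem -enumT es /= !inE /= ; congr (map _ _).
apply: eq_in_filter => j jr; rewrite !inE; case: eqP => [j0|]; last by rewrite andbT.
by rewrite -j0 jr in r0.
Qed.


Let Mcons y t : M (y :: t) = conv (fun u => kappa (y :: u)) M t.
Proof. by rewrite /M big_cons moment_cons. Qed.

Let M0 : M [::] = 1. Proof. by rewrite /M big_nil. Qed.

Let M_perm s t : perm_eq s t -> M s = M t.
Proof. by move=> st; congr mom; exact: perm_big. Qed.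

(** The formula lists every block in increasing order, so symmetry has to be derived. A swap away
    from the head is divided out by [conv_cancel_swap]; a swap of the first two entries needs the
    recursion twice. *)
Lemma kappa_perm s t : perm_eq s t -> kappa s = kappa t.
Proof.
have swapA (B : eqType) (p : seq B) y z t' : perm_eq (p ++ y :: z :: t') (p ++ z :: y :: t').
  by rewrite perm_cat2l -(cat1s z) -(cat1s y) perm_catCA.
apply: swap_invariant_perm => p y z u; case: p => [|x p] /=; last first.
  apply: (conv_cancel_swap M0 (F := fun v => kappa (x :: v))) => [|] p' y' z' u'.
    exact/M_perm/swapA.
  by have := M_perm (swapA _ (x :: p') y' z' u'); rewrite -!moment_cons /M !cat_cons !big_cons.
apply: (conv_cancel (F := fun v => kappa [:: y, z & v]) (F' := fun v => kappa [:: z, y & v]) M0).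
(* Expanding a moment in [a] and then in [b] isolates the terms in which the two share a block; the
   terms that are subtracted are symmetric in [a] and [b]. *)
move=> v; have xy a b : conv (fun v => kappa [:: a, b & v]) M v =
    M [:: a, b & v] - conv (conv (fun v => kappa (a :: v)) (fun v => kappa (b :: v))) M v.
  rewrite -convA Mcons /= (eq_conv (frefl _) (Mcons b)); ring.
rewrite !xy (M_perm (swapA _ [::] y z v)); congr (_ - _).
by apply: eq_conv => // v'; apply: convC.
Qed.

Lemma kappa_one s : kappa (1 :: s) = nil_indicator F s.
Proof.
apply: (conv_cancel (F := fun v => kappa (1 :: v)) M0) => v.
by rewrite -moment_cons mul1r conv1.
Qed.

Lemma kappa_linear c x y s :
  kappa ((c *: x + y) :: s) = c * kappa (x :: s) + kappa (y :: s).
Proof.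
apply: (conv_cancel (F := fun v => kappa ((c *: x + y) :: v))
  (F' := fun v => c * kappa (x :: v) + kappa (y :: v)) M0) => v.
by rewrite convDl convZl -!moment_cons -mom_linear scalerAl -mulrDl.
Qed.

(** The same moment is peeled with [x * y] as one entry or with [x] and [y] as two; in the second
    case [y] either shares the block of [x] or has a block of its own. *)
Lemma kappa_mul x y s :
  kappa (x * y :: s) = kappa [:: x, y & s]
    + conv (fun u => kappa (x :: u)) (fun u => kappa (y :: u)) s.
Proof.
apply: (conv_cancel (F := fun v => kappa (x * y :: v)) (F' := fun v => kappa [:: x, y & v]
    + conv (fun u => kappa (x :: u)) (fun u => kappa (y :: u)) v) M0) => v.
have yv : y * \prod_(o <- v) o = \prod_(o <- y :: v) o by rewrite big_cons.
rewrite convDl -convA -moment_cons -mulrA yv moment_cons /=.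
by congr (_ + _); apply: eq_conv => // u; apply: Mcons.
Qed.

Lemma kappa1 x : kappa [:: x] = mom x.
Proof. by have := moment_cons x [::]; rewrite big_nil mulr1 /= M0 mulr1. Qed.

End Cumulants.

(** * Hypertrees *)

Section Hypertrees.
Variable X : finType.
Implicit Types (V W Y D I J : {set X}) (U : {set {set X}}).

Definition crosses V Y : bool := (V :&: Y != set0) && (V :\: Y != set0).

Lemma crossesP V Y :
  reflect (exists x y, [/\ x \in V, x \in Y, y \in V & y \notin Y]) (crosses V Y).
Proof.
apply: (iffP andP) => [[/set0Pn[x /setIP[xV xY]] /set0Pn[y /setDP[yV yY]]]|].
  by exists x, y.
by move=> [x [y [xV xY yV yY]]]; split; apply/set0Pn; [exists x|exists y]; apply/setIP + apply/setDP.
Qed.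

Definition connects U D : bool :=
  [forall Y : {set X}, [&& Y \subset D, Y != set0 & Y != D] ==>
     [exists V in U, crosses V Y]].

Definition excess U : nat := \sum_(V in U) #|V|.-1.

(** By [card_le_excess], [#|D|.-1] is the least excess of a connecting family; equality rules out
    cycles. *)
Definition hypertree U D : bool :=
  [&& [forall V in U, (V \subset D) && (1 < #|V|)%N], connects U D
    & excess U == #|D|.-1].

(** An edge inside [D] crosses a set exactly when it crosses its complement in [D], so cuts through
    a chosen vertex suffice. *)
Lemma connects_at U D k :
  k \in D -> (forall V, V \in U -> V \subset D) ->
  reflect (forall Y, k \in Y -> Y \subset D -> Y != D -> exists2 V, V \in U & crosses V Y)
    (connects U D).
Proof.
move=> kD UD; apply: (iffP forallP) => [H Y kY YD YnD|H Y].
  have /implyP/(_ _)/exists_inP := H Y; apply.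
  by rewrite YD YnD andbT; apply/set0Pn; exists k.
apply/implyP => /and3P[YD Y0 YnD].
have [kY|kY] := boolP (k \in Y).
  by have [V VU cV] := H Y kY YD YnD; apply/exists_inP; exists V.
have [|||V VU /crossesP[x [y [xV xY yV yY]]]] := H (D :\: Y).
- by rewrite inE kY.
- exact: subsetDl.
- apply/eqP => DY; have [x xY] := set0Pn _ Y0; have xD := subsetP YD x xY.
  by move: xD; rewrite -DY inE xY.
apply/exists_inP; exists V => //; apply/crossesP; exists y, x; split => //.
  by move: yY; rewrite inE (subsetP (UD V VU) y yV) andbT negbK.
by move: xY; rewrite inE => /andP[].
Qed.

Lemma excess_subset U U' : U' \subset U -> (excess U' <= excess U)%N.
Proof.
by move=> UU; rewrite /excess [X in (_ <= X)%N](big_setID U') /= (setIidPr UU) leq_addr.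
Qed.

(** A component grown from one vertex by crossing edges gains at most [#|V|.-1] vertices per edge,
    since the new edge already meets it. *)
Lemma card_le_excess U D :
  (forall V, V \in U -> V \subset D) -> connects U D -> (#|D|.-1 <= excess U)%N.
Proof.
move=> UD /forallP connU.
have [->|[k kD]] := set_0Vmem D; first by rewrite cards0.
(* [Y] is the part reached so far, [U'] the edges used, all inside [Y], and [n] bounds the number of
   vertices still missing. *)
suff H n Y U' : (#|D :\: Y| <= n)%N -> Y \subset D -> Y != set0 -> U' \subset U ->
    (forall V, V \in U' -> V \subset Y) -> (#|Y|.-1 <= excess U')%N ->
    (#|D|.-1 <= excess U)%N.
  apply: (H _ [set k] set0 (leqnn _)); rewrite ?sub1set ?sub0set ?cards1 //.
    by apply/set0Pn; exists k; rewrite inE.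
  by move=> V; rewrite inE.
elim: n Y U' => [|n IH] Y U' DYn YD Y0 U'U U'Y YU'.
  have -> : D = Y; last exact: leq_trans YU' (excess_subset U'U).
  by apply/eqP; rewrite eqEsubset YD andbT -setD_eq0 -cards_eq0 -leqn0.
have [DY|YnD] := eqVneq Y D; first by rewrite -DY; apply: leq_trans YU' (excess_subset U'U).
have /implyP/(_ _)/exists_inP[|V VU cV] := connU Y; first by rewrite YD Y0.
have /crossesP[x [y [xV xY yV yY]]] := cV.
have VU' : V \notin U' by apply: contra yY => /U'Y/subsetP; apply.
apply: (IH (Y :|: V) (V |: U')).
- rewrite -ltnS; apply: leq_trans DYn; apply: proper_card; apply/properP.
  split; first by apply: setDS; apply: subsetUl.
  by exists y; rewrite !inE ?yV ?orbT // yY (subsetP (UD V VU)).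
- by rewrite subUset YD UD.
- by apply/set0Pn; exists y; rewrite inE yV orbT.
- by rewrite subUset sub1set VU.
- move=> W /setU1P[->|/U'Y WY]; first exact: subsetUr.
  by apply: subset_trans WY _; apply: subsetUl.
rewrite /excess big_setU1 //= -/(excess U').
have := cardsUI Y V; have : (0 < #|Y :&: V|)%N by apply/card_gt0P; exists x; rewrite inE xY.
have : (0 < #|V|)%N by apply/card_gt0P; exists x.
by move: YU'; clear; lia.
Qed.

Lemma hypertree_sub U D V : hypertree U D -> V \in U -> V \subset D.
Proof. by case/and3P => /forall_inP H _ _ /H /andP[]. Qed.

Lemma hypertree_gt1 U D V : hypertree U D -> V \in U -> (1 < #|V|)%N.
Proof. by case/and3P => /forall_inP H _ _ /H /andP[]. Qed.

Section Branch.
Variables (U : {set {set X}}) (D V : {set X}) (k : X).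
Hypotheses (treeU : hypertree U D) (VU : V \in U) (kV : k \in V).

(* The vertices of D' that remain joined to k once the edge V' is deleted. *)
Definition trunk (U' : {set {set X}}) (D' V' : {set X}) : {set X} :=
  \bigcap_(Y : {set X} | [&& k \in Y, Y \subset D' & [forall W in U' :\ V', ~~ crosses W Y]]) Y.

Let J := trunk U D V.
Let UD W : W \in U -> W \subset D. Proof. exact: hypertree_sub treeU. Qed.
Let kD : k \in D. Proof. exact: subsetP (UD VU) k kV. Qed.

Let kJ : k \in J.
Proof. by apply/bigcapP => Y /and3P[]. Qed.

Let no_cross_subset W Y : W \subset Y -> ~~ crosses W Y.
Proof. by rewrite /crosses -setD_eq0 => ->; rewrite andbF. Qed.

Let JD : J \subset D.
Proof.
apply: bigcap_inf; rewrite kD subxx /=; apply/forall_inP => W /setD1P[_ WU].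
exact/no_cross_subset/UD.
Qed.

Let J_uncrossed W : W \in U -> W != V -> ~~ crosses W J.
Proof.
move=> WU WV; apply/negP => /crossesP[x [y [xW xJ yW /negP yJ]]]; apply: yJ.
apply/bigcapP => Y PY; have /and3P[_ _ /forall_inP H] := PY.
apply: contraT => yY; suff : crosses W Y by rewrite (negbTE (H W _)) // !inE WV.
by apply/crossesP; exists x, y; split=> //; apply: (bigcapP xJ).
Qed.

Let J_min Y : k \in Y -> Y \subset D -> (forall W, W \in U -> W != V -> ~~ crosses W Y) ->
  J \subset Y.
Proof.
move=> kY YD H; apply: bigcap_inf; rewrite kY YD /=.
by apply/forall_inP => W /setD1P[WV WU]; apply: H.
Qed.

Let U2 := [set W in U | (W != V) && (W \subset J)].
Let U1 := [set W in U | (W != V) && ~~ (W \subset J)].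
(** Nothing yet forbids [V] from meeting the trunk outside [k], so the branch is first built with
    the shrunken edge [V']; [counting] then forces [V' = V]. *)
Let V' := k |: (V :\: J).
Let D1 := k |: (D :\: J).

Let U1J W : W \in U1 -> [disjoint W & J].
Proof.
rewrite !inE => /and3P[WU WV WJ]; have := J_uncrossed WU WV.
by rewrite /crosses negb_and !negbK setD_eq0 (negbTE WJ) orbF -setI_eq0.
Qed.

Let V'U1 : V' \notin U1.
Proof.
apply/negP => /U1J/pred0P/(_ k); rewrite /= !inE eqxx kJ.
by [].
Qed.

(** A set inside [J] through [k] that no edge of [U2] crosses is crossed by no edge other than [V],
    so it contains [J] by minimality. *)
Let conn2 : connects U2 J.
Proof.
apply/(connects_at kJ) => [W|Y kY YJ YnJ]; first by rewrite !inE => /and3P[].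
have [/exists_inP//|H] := boolP [exists W in U2, crosses W Y].
case/negP: YnJ; rewrite eqEsubset YJ J_min //; first exact: subset_trans YJ JD.
move=> W WU WV; apply/negP => cW; case/negP: H; apply/exists_inP; exists W => //.
rewrite inE WU WV /=; apply: contraT => WJ.
have /U1J/pred0P dWJ: W \in U1 by rewrite inE WU WV.
have /crossesP[x [y [xW xY _ _]]] := cW.
by have := dWJ x; rewrite /= xW (subsetP YJ).
Qed.

Let U1'D1 W : W \in V' |: U1 -> W \subset D1.
Proof.
case/setU1P => [->|WU1]; first by apply/setUS/setSD/UD.
have := U1J WU1; move: WU1; rewrite !inE => /and3P[/UD WD _ _] dWJ.
apply: subset_trans (subsetUr _ _); apply/subsetP => x xW.
rewrite inE (subsetP WD) // andbT; apply/negP => xJ.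
by have /pred0P/(_ x) := dWJ; rewrite /= xW xJ.
Qed.

(** A cut [Y] of the branch is tested as the cut [Y :|: J] of the whole tree, as if the trunk were
    contracted to [k]. *)
Let conn1 : connects (V' |: U1) D1.
Proof.
apply/(connects_at (k := k)) => //; first by rewrite !inE eqxx.
move=> Y kY YD1 YnD1.
have /and3P[_ connU _] := treeU.
have YJD : Y :|: J \subset D.
  rewrite subUset JD andbT; apply: subset_trans YD1 _.
  by rewrite subUset sub1set kD subsetDl.
have YJnD : Y :|: J != D.
  apply: contra YnD1 => /eqP YJ; rewrite eqEsubset YD1 subUset sub1set kY /=.
  by rewrite -YJ; apply/subsetP => x; rewrite !inE; case: (x \in J); rewrite ?orbF.
have kYJ : k \in Y :|: J by rewrite inE kY.
have [W WU /crossesP[x [y [xW xYJ yW yYJ]]]] := connects_at kD UD connU _ kYJ YJD YJnD.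
have [yY yJ] : y \notin Y /\ y \notin J by apply/norP; rewrite inE in yYJ.
have [WV|WV] := eqVneq W V.
  exists V'; first by rewrite setU11.
  apply/crossesP; exists k, y; rewrite kY yY setU11; split => //.
  by rewrite !inE yJ -WV yW orbT.
have WU1 : W \in U1.
  by rewrite inE WU WV; apply: contra yJ => /subsetP; apply.
exists W; first by rewrite inE WU1 orbT.
apply/crossesP; exists x, y; split => //.
move: xYJ; rewrite inE => /orP[//|xJ].
by have /pred0P/(_ x) := U1J WU1; rewrite /= xW xJ.
Qed.

Let excessU : excess U = (#|V|.-1 + excess U1 + excess U2)%N.
Proof.
rewrite /excess (big_setD1 V) //= -addnA; congr (_ + _)%N.
rewrite (bigID (fun W => W \subset J)) /= addnC; congr (_ + _)%N;
  by apply: eq_bigl => W; rewrite !inE -!andbA; case: (W == V); rewrite ?andbF //=.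
Qed.

Let counting : [/\ #|V'| = #|V|, excess U2 = #|J|.-1 & (#|V|.-1 + excess U1 = #|D1|.-1)%N].
Proof.
have c2 := card_le_excess (U := U2) (D := J) _ conn2.
have {c2} c2 : (#|J|.-1 <= excess U2)%N by apply: c2 => W; rewrite !inE => /and3P[].
have := card_le_excess U1'D1 conn1.
rewrite {1}/excess big_setU1 //= -/(excess U1) => c1.
have /and3P[_ _ /eqP cU] := treeU; rewrite excessU in cU.
have V'V : (#|V'| <= #|V|)%N.
  apply: subset_leq_card; rewrite subUset sub1set kV; exact: subsetDl.
have cD1 : (#|D1| = (#|D| - #|J|).+1)%N.
  by rewrite cardsU1 inE kJ /= cardsD (setIidPr JD).
have J0 : (0 < #|J|)%N by apply/card_gt0P; exists k.
have JleD := subset_leq_card JD.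
have V0 := hypertree_gt1 treeU VU.
have V'0 : (0 < #|V'|)%N by apply/card_gt0P; exists k; rewrite setU11.
by clear -c1 c2 cU V'V cD1 J0 JleD V0 V'0; split; lia.
Qed.

Let V'V : V' = V.
Proof.
have [c _ _] := counting; apply/eqP; rewrite eqEcard c leqnn andbT.
by rewrite subUset sub1set kV subsetDl.
Qed.

Let VJ : ~~ (V \subset J).
Proof.
apply/negP => VJ; have := hypertree_gt1 treeU VU.
have /eqP V0 : V :\: J == set0 by rewrite setD_eq0.
by rewrite -V'V /V' V0 setU0 cards1.
Qed.

Let U2E : [set W in U | W \subset J] = U2.
Proof.
apply/setP => W; rewrite !inE; case: eqP => [->|] //=.
by rewrite (negbTE VJ) andbF.
Qed.

Let U1E : [set W in U | ~~ (W \subset J)] = V |: U1.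
Proof.
apply/setP => W; rewrite !inE; case: eqP => [->|] //=.
by rewrite VJ VU.
Qed.

Lemma trunk_sub : k \in J /\ J \subset D.
Proof. by []. Qed.

Lemma hypertree_trunk : hypertree [set W in U | W \subset J] J.
Proof.
have [_ c _] := counting; rewrite U2E /hypertree conn2 c eqxx !andbT.
apply/forall_inP => W; rewrite !inE => /and3P[WU _ ->].
exact: hypertree_gt1 treeU WU.
Qed.

Lemma hypertree_branch : hypertree [set W in U | ~~ (W \subset J)] (k |: (D :\: J)).
Proof.
have [_ _ c] := counting; have VU1 := V'U1; have c1 := conn1; rewrite V'V in VU1 c1.
rewrite U1E /hypertree c1 /excess big_setU1 //= -/(excess U1) c eqxx !andbT.
apply/forall_inP => W WU; rewrite U1'D1 ?V'V //=.
apply: hypertree_gt1 treeU _.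
by case/setU1P: WU => [->//|]; rewrite inE => /and3P[].
Qed.

(** Every other edge of the branch misses [J], which contains [k]. This condition recovers [V] from
    the branch when the pieces are joined again. *)
Lemma branch_at : [set W in [set W in U | ~~ (W \subset J)] | k \in W] = [set V].
Proof.
rewrite U1E; apply/setP => W; rewrite !inE; have [->|WV] /= := eqVneq W V; first by rewrite kV.
apply/negP => /andP[WU1 kW].
have /U1J/pred0P/(_ k): W \in U1 by rewrite inE WV.
by rewrite /= kW kJ.
Qed.

End Branch.

Section Join.
Variables (U1 U2 : {set {set X}}) (D I : {set X}) (k : X).
Hypotheses (kD : k \in D) (ID : I \subset D :\ k).
Hypotheses (tree1 : hypertree U1 (k |: I)) (tree2 : hypertree U2 (D :\: I)).

Let kI : k \notin I.
Proof. by apply/negP => /(subsetP ID); rewrite !inE eqxx. Qed.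

Let ID' : I \subset D.
Proof. exact: subset_trans ID (subD1set _ _). Qed.

Let kDI : k \in D :\: I.
Proof. by rewrite inE kI kD. Qed.

Let U1sub W : W \in U1 -> ~~ (W \subset D :\: I).
Proof.
move=> W1; have WkI := hypertree_sub tree1 W1.
apply: contraL (hypertree_gt1 tree1 W1) => WDI; rewrite -leqNgt -(cards1 k).
apply/subset_leq_card/subsetP => x xW; have := subsetP WkI x xW; have := subsetP WDI x xW.
by rewrite !inE => /andP[/negbTE ->]; rewrite orbF.
Qed.

Lemma join_disjoint : [disjoint U1 & U2].
Proof.
apply/pred0P => W /=; apply/negP => /andP[/U1sub/negP W1 W2]; apply: W1.
exact: hypertree_sub tree2 W2.
Qed.

(** The two vertex sets share only [k], so the excesses [#|I|] and [#|D :\: I|.-1] add up to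
    [#|D|.-1]. *)
Lemma hypertree_join : hypertree (U1 :|: U2) D.
Proof.
have sub W : W \in U1 :|: U2 -> W \subset D.
  case/setUP => [/(hypertree_sub tree1)|/(hypertree_sub tree2)] /subset_trans; apply.
    by rewrite subUset sub1set kD.
  exact: subsetDl.
apply/and3P; split.
- apply/forall_inP => W WU; rewrite sub //=.
  by case/setUP: WU; [apply: hypertree_gt1 tree1|apply: hypertree_gt1 tree2].
- apply/(connects_at kD sub) => Y kY YD YnD.
  have [DIY|] := boolP (D :\: I \subset Y); last first.
    move=> nDIY; have /and3P[_ conn2 _] := tree2.
    have [|||W W2 /crossesP[x [y [xW xY yW yY]]]] :=
      connects_at kDI (fun V => @hypertree_sub _ _ V tree2) conn2 (Y :&: (D :\: I)).
    + by rewrite inE kY kDI.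
    + exact: subsetIr.
    + by apply: contra nDIY => /eqP <-; exact: subsetIl.
    exists W; first by rewrite inE W2 orbT.
    apply/crossesP; exists x, y; split => //; first by case/setIP: xY.
    by move: yY; rewrite inE (subsetP (hypertree_sub tree2 W2) _ yW) andbT.
  have /and3P[_ conn1 _] := tree1.
  have [|||W W1 /crossesP[x [y [xW xY yW yY]]]] :=
    connects_at (setU11 k I) (fun V => @hypertree_sub _ _ V tree1) conn1 (Y :&: (k |: I)).
  + by rewrite inE kY setU11.
  + exact: subsetIr.
  + apply: contra YnD => /eqP YI; rewrite eqEsubset YD /= -(setID D I) subUset DIY andbT.
    apply: subset_trans (subsetIr _ _) _; apply: subset_trans (subsetUr [set k] _) _.
    by rewrite -YI subsetIl.
  exists W; first by rewrite inE W1.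
  apply/crossesP; exists x, y; split => //; first by case/setIP: xY.
  by move: yY; rewrite inE (subsetP (hypertree_sub tree1 W1) _ yW) andbT.
have /and3P[_ _ /eqP c1] := tree1; have /and3P[_ _ /eqP c2] := tree2.
rewrite /excess (eq_bigl [predU U1 & U2]); last by move=> W; rewrite !inE.
rewrite bigU ?join_disjoint //= -/(excess U1) -/(excess U2) c1 c2.
rewrite cardsU1 kI -(cardsID I D) (setIidPr ID') add1n /=.
have : (0 < #|D :\: I|)%N by apply/card_gt0P; exists k.
by lia.
Qed.

(** Cutting undoes joining: apart from [V] no edge crosses [D :\: I], and a smaller set through [k]
    would be crossed by an edge of [U2]. *)
Lemma trunk_join V : [set W in U1 | k \in W] = [set V] -> trunk k (U1 :|: U2) D V = D :\: I.
Proof.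
move=> kV; have V1 : V \in U1 by have := set11 V; rewrite -kV inE => /andP[].
have kinV : k \in V by have := set11 V; rewrite -kV inE => /andP[].
have treeU := hypertree_join.
have VU : V \in U1 :|: U2 by rewrite inE V1.
have JDI : trunk k (U1 :|: U2) D V \subset D :\: I.
  apply: bigcap_inf; rewrite kDI subsetDl /=.
  apply/forall_inP => W /setD1P[WV /setUP[W1|/(hypertree_sub tree2) WDI]]; last first.
    by rewrite /crosses -setD_eq0 in WDI *; rewrite WDI andbF.
  apply/negP => /crossesP[x [y [xW xDI _ _]]].
  move: WV; rewrite -in_set1 -kV inE W1 /=.
  have := subsetP (hypertree_sub tree1 W1) x xW.
  move: xDI; rewrite !inE => /andP[/negbTE -> _]; rewrite orbF => /eqP xk.
  by rewrite -xk xW.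
apply/eqP; rewrite eqEsubset JDI /=; apply: contraT => nJ.
have [kJ JD] := trunk_sub treeU VU kinV.
have /and3P[_ conn2 _] := tree2.
have [|W W2 cW] := connects_at kDI (fun V => @hypertree_sub _ _ V tree2) conn2 _ kJ JDI.
  by apply: contra nJ => /eqP ->.
have WV : W != V.
  by apply: contraTneq W2 => ->; have /pred0P/(_ V) := join_disjoint; rewrite /= V1 => /= ->.
have /crossesP[x [y [xW xJ yW]]] := cW; case/bigcapP => Y PY.
have /and3P[_ _ /forall_inP H] := PY; apply: contraT => yY.
have : crosses W Y by apply/crossesP; exists x, y; split => //; exact: (bigcapP xJ).
by rewrite (negbTE (H W _)) // !inE WV W2 orbT.
Qed.

Lemma trunk_edges : [set W in U1 :|: U2 | W \subset D :\: I] = U2.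
Proof.
apply/setP => W; rewrite !inE; apply/idP/idP => [/andP[/orP[/U1sub/negbTE ->|]]//|W2].
by rewrite W2 orbT (hypertree_sub tree2).
Qed.

Lemma branch_edges : [set W in U1 :|: U2 | ~~ (W \subset D :\: I)] = U1.
Proof.
apply/setP => W; rewrite !inE; apply/idP/idP => [/andP[/orP[]// W2]|W1].
  by rewrite (hypertree_sub tree2).
by rewrite W1 U1sub.
Qed.

End Join.

(* Cutting the hypertree U at the vertex k of its edge V: U1 is the branch
   behind V, with vertices k |: I, and U2 what remains. *)
Lemma hypertree_sum_cut (R : nmodType) (D : {set X}) (k : X)
    (w : {set {set X}} -> {set X} -> R) :
  k \in D ->
  \sum_(U | hypertree U D) \sum_(V in U | k \in V) w U V =
  \sum_(I : {set X} | I \subset D :\ k)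
    \sum_(U1 | hypertree U1 (k |: I)) \sum_(U2 | hypertree U2 (D :\: I))
      \sum_(V | [set W in U1 | k \in W] == [set V]) w (U1 :|: U2) V.
Proof.
move=> kD; rewrite pair_big_dep.
under [RHS]eq_bigr do under eq_bigr do rewrite pair_big_dep.
under [RHS]eq_bigr do rewrite pair_big_dep.
rewrite pair_big_dep /=.
pose h (p : {set {set X}} * {set X}) :=
  let J := trunk k p.1 D p.2 in
  (D :\: J, ([set W in p.1 | ~~ (W \subset J)], ([set W in p.1 | W \subset J], p.2))).
pose h' (p : {set X} * ({set {set X}} * ({set {set X}} * {set X}))) :=
  (p.2.1 :|: p.2.2.1, p.2.2.2).
rewrite [RHS](reindex_onto h h') /=; last first.
  move=> [I [U1 [U2 V]]] /= /and4P[ID t1 t2 /eqP kV].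
  rewrite /h /h' /= (trunk_join kD ID t1 t2 kV) (trunk_edges t1 t2).
  rewrite (branch_edges t1 t2) setDDr setDv set0U (setIidPr _) //.
  exact: subset_trans ID (subD1set _ _).
have UE (U : {set {set X}}) J :
    [set W in U | ~~ (W \subset J)] :|: [set W in U | W \subset J] = U.
  by apply/setP => W; rewrite !inE; case: (W \subset J); rewrite ?andbF ?andbT ?orbF.
apply: eq_big => [[U V]|[U V] _] /=; last by rewrite UE.
rewrite /h' /= UE eqxx andbT.
apply/and3P/and4P => [[tU VU kV]|[DJ t1 t2 /eqP kV]].
  have [kJ JD] := trunk_sub tU VU kV; split.
  - by apply/subsetP => x; rewrite !inE => /andP[xJ ->]; rewrite andbT;
      apply: contraNneq xJ => ->.
  - exact: hypertree_branch.
  - rewrite setDDr setDv set0U (setIidPr JD); exact: hypertree_trunk.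
  - by rewrite branch_at.
have := set11 V; rewrite -kV !inE => /andP[/andP[VU _] kinV]; split => //.
have := hypertree_join kD DJ t1 t2.
by rewrite UE.
Qed.

End Hypertrees.

(** * Labelled hypertrees *)

(** Words read off different edge sets get a common index list, the enumeration of [T], so that they
    can be compared entry by entry. *)
Lemma pmap_enum (T : finType) (B : Type) (f : T -> option B) (P : {set T}) :
  pmap f (enum P) = pmap (fun x => if x \in P then f x else None) (enum T).
Proof.
rewrite {1}/enum_mem -enumT; elim: (enum T) => //= x s IH.
by case: (x \in P) => /=; rewrite IH.
Qed.

Lemma eq_pmap_enum (T : finType) (B : Type) (f g : T -> option B) (P Q : {set T}) :
  (forall x, (if x \in P then f x else None) = (if x \in Q then g x else None)) ->
  pmap f (enum P) = pmap g (enum Q).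
Proof. by move=> fg; rewrite !pmap_enum; apply: eq_pmap. Qed.

Section LabelledTrees.
Variables (X L : finType) (R : comPzRingType) (S : seq L -> R) (x : L -> R).
Implicit Types (D I V W : {set X}) (U : {set {set X}}).
Local Notation labelling := {ffun {set X} * X -> option L}.
Implicit Types (a : labelling) (G : X -> seq L -> R).

Definition labels U a : bool :=
  [forall p : {set X} * X, (a p != None) == (p.1 \in U) && (p.2 \in p.1)].

Definition edge_word a V : seq L := pmap (fun k => a (V, k)) (enum V).

Definition vertex_word a U k : seq L := pmap (fun V => a (V, k)) (enum U).

(** With [G k] the iterated derivatives of the polynomial at [k], this is the contribution of one
    cover. A general [G] allows one vertex to be changed at a time. *)
Definition weight D G U : R :=
  \sum_(a | labels U a)
    (\prod_(V in U) S (edge_word a V)) * \prod_(k in D) G k (vertex_word a U k).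

Definition tree_sum D G : R := \sum_(U | hypertree U D) weight D G U.

Definition upd (B : Type) (f : X -> B) (k : X) (v : B) : X -> B :=
  fun j => if j == k then v else f j.

(* The derivatives, indexed by words, of the monomial q_b at the point x. *)
Definition letter_deriv (b : L) (u : seq L) : R :=
  match u with [::] => x b | [:: c] => (c == b)%:R | _ => 0 end.

Lemma labelsP U a V k : labels U a -> (a (V, k) != None) = (V \in U) && (k \in V).
Proof. by move=> /forallP/(_ (V, k))/eqP. Qed.

Lemma labels_None U a V k : labels U a -> ~~ ((V \in U) && (k \in V)) -> a (V, k) = None.
Proof. by move=> aU; rewrite -(labelsP _ _ aU) negbK => /eqP. Qed.

Lemma size_vertex_word U a k : labels U a ->
  size (vertex_word a U k) = #|[set W in U | k \in W]|.
Proof.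
move=> aU; rewrite size_pmap -size_filter cardE; congr size.
rewrite /enum_mem -filter_predI; apply: eq_filter => W; rewrite !inE /=.
have := labelsP W k aU; case: (W \in U); rewrite ?andbF //= => <-.
by case: (a _).
Qed.

Definition merge U1 a1 a2 : labelling := [ffun p => if p.1 \in U1 then a1 p else a2 p].

Lemma sum_merge U1 U2 (h : labelling -> R) :
  [disjoint U1 & U2] ->
  \sum_(a | labels (U1 :|: U2) a) h a =
  \sum_(a1 | labels U1 a1) \sum_(a2 | labels U2 a2) h (merge U1 a1 a2).
Proof.
move=> dU; rewrite pair_big /=.
pose restr U a : labelling := [ffun p => if p.1 \in U then a p else None].
rewrite (reindex_onto (fun p : labelling * labelling => merge U1 p.1 p.2)
  (fun a => (restr U1 a, restr U2 a))) /=; last first.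
  move=> a aU; apply/ffunP => [[V k]]; rewrite !ffunE /=.
  case: (boolP (V \in U1)) => // V1; case: (boolP (V \in U2)) => // V2.
  by rewrite (labels_None aU) // inE (negbTE V1) (negbTE V2).
apply: eq_bigl => [[a1 a2]] /=; apply/andP/andP => [[aU /eqP[e1 e2]]|[l1 l2]].
  have h1 p : restr U1 (merge U1 a1 a2) p = a1 p by rewrite e1.
  have h2 p : restr U2 (merge U1 a1 a2) p = a2 p by rewrite e2.
  split; apply/forallP => [[V k]]; have := labelsP V k aU;
    move: (h1 (V, k)) (h2 (V, k)); rewrite !ffunE /= inE.
    by case: (V \in U1) => /= [_ _ ->|<- _ _].
  case: (boolP (V \in U2)) => V2 /=; last by move=> _ <-.
  have /pred0P/(_ V) := dU; rewrite /= V2 andbT => /= ->.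
  by move=> _ _ ->.
have nU V : V \in U1 -> V \in U2 -> false.
  by move=> V1 V2; have /pred0P/(_ V) := dU; rewrite /= V1 V2.
split.
  apply/forallP => [[V k]]; rewrite !ffunE inE /=.
  case: ifP => V1; first by rewrite (labelsP _ _ l1) V1.
  by rewrite (labelsP _ _ l2).
apply/eqP; congr pair; apply/ffunP => [[V k]]; rewrite !ffunE /=.
  case: (boolP (V \in U1)) => // V1.
  by rewrite (labels_None l1) // (negbTE V1).
case: (boolP (V \in U2)) => V2; last by rewrite (labels_None l2) // (negbTE V2).
by case: ifP => // V1; have := nU _ V1 V2.
Qed.

(** [letter_deriv b] vanishes on words of length at least two, so the surviving deals give it
    nothing or the label of a single edge [V]. *)
Lemma conv_letter_deriv (b : L) (g : seq L -> R) (f : {set X} -> option L) U :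
  conv (letter_deriv b) g (pmap f (enum U)) =
  x b * g (pmap f (enum U)) +
  \sum_(V in U) (f V == Some b)%:R * g (pmap f (enum (U :\ V))).
Proof.
have leafS c g' u : conv (fun u => letter_deriv b (c :: u)) g' u = (c == b)%:R * g' u.
  rewrite -(conv1 g') -convZl; apply: eq_conv => // v.
  by rewrite /nil_indicator; case: v => [|d v] /=; rewrite ?mulr1 ?mulr0.
have conv_seq r : uniq r -> conv (letter_deriv b) g (pmap f r) = x b * g (pmap f r) +
    \sum_(V <- r) (f V == Some b)%:R * g (pmap f [seq W <- r | W != V]).
  elim: r g => [|V r IH] g' /=; first by rewrite big_nil addr0.
  case/andP=> Vr ur; rewrite big_cons eqxx /=.
  have rV : [seq W <- r | W != V] = r.
    by apply/all_filterP/allP => W Wr; apply: contraNneq Vr => <-.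
  have tail (h : seq L -> R) : \sum_(W <- r) (f W == Some b)%:R *
      h (pmap f (if V != W then V :: [seq W' <- r | W' != W] else [seq W' <- r | W' != W])) =
    \sum_(W <- r) (f W == Some b)%:R * h (pmap f (V :: [seq W' <- r | W' != W])).
    by apply: eq_big_seq => W Wr; have -> : V != W by rewrite eq_sym (memPn Vr).
  rewrite rV tail /=.
  case fV: (f V) => [c|] /=; last by rewrite mul0r add0r IH.
  rewrite leafS IH // (_ : (Some c == Some b) = (c == b)) //; ring.
rewrite conv_seq ?enum_uniq // big_enum /=; congr (_ + _); apply: eq_bigr => V VU.
congr (_ * g (pmap f _)); rewrite /enum_mem -filter_predI; apply: eq_filter => W.
by rewrite /= !inE.
Qed.

Lemma labels_tree_None U D a V k :
  labels U a -> hypertree U D -> k \notin D -> a (V, k) = None.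
Proof.
move=> aU tU kD; apply: (labels_None aU); apply: contra kD => /andP[/(hypertree_sub tU)].
by move/subsetP; apply.
Qed.

Lemma eq_weight D G G' U :
  (forall k, k \in D -> G k =1 G' k) -> weight D G U = weight D G' U.
Proof.
move=> eG; apply: eq_bigr => a _; congr (_ * _); apply: eq_bigr => k kD; exact: eG.
Qed.

Lemma eq_tree_sum D G G' : (forall k, k \in D -> G k =1 G' k) -> tree_sum D G = tree_sum D G'.
Proof. by move=> eG; apply: eq_bigr => U _; apply: eq_weight. Qed.

(** Vertices in [I] see only edges of [U1], those outside [k |: I] only edges of [U2]; at [k] the
    edge [V] belongs to [U1] and all others to [U2]. Hence the weight factorises. *)
Lemma weight_merge (D I : {set X}) (k : X) (b : L) (g : seq L -> R) G U1 U2 V :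
  k \in D -> I \subset D :\ k ->
  hypertree U1 (k |: I) -> hypertree U2 (D :\: I) ->
  [set W in U1 | k \in W] = [set V] ->
  \sum_(a | labels (U1 :|: U2) a)
    (\prod_(W in U1 :|: U2) S (edge_word a W)) *
    ((a (V, k) == Some b)%:R * g (pmap (fun W => a (W, k)) (enum ((U1 :|: U2) :\ V))) *
     \prod_(j in D :\ k) G j (vertex_word a (U1 :|: U2) j)) =
  weight (k |: I) (upd G k (letter_deriv b)) U1 * weight (D :\: I) (upd G k g) U2.
Proof.
move=> kD ID t1 t2 U1k; have dU := join_disjoint t1 t2.
have /andP[V1 kV] : (V \in U1) && (k \in V) by have := set11 V; rewrite -U1k inE.
have kI : k \notin I by apply/negP => /(subsetP ID); rewrite !inE eqxx.
rewrite sum_merge // /weight mulr_suml; apply: eq_bigr => a1 l1.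
rewrite mulr_sumr; apply: eq_bigr => a2 l2.
have nU2 W : W \in U2 -> W \in U1 = false.
  by move=> W2; have /pred0P/(_ W) := dU; rewrite /= W2 andbT.
rewrite (eq_bigl [predU U1 & U2]) ?bigU //=; last by move=> W; rewrite !inE.
rewrite [X in _ * (_ * X) = _](big_setID I) /= (setIidPr ID).
have -> : \prod_(W in U1) S (edge_word (merge U1 a1 a2) W) = \prod_(W in U1) S (edge_word a1 W).
  by apply: eq_bigr => W W1; congr S; apply: eq_pmap => j; rewrite ffunE /= W1.
have -> : \prod_(W in U2) S (edge_word (merge U1 a1 a2) W) = \prod_(W in U2) S (edge_word a2 W).
  by apply: eq_bigr => W W2; congr S; apply: eq_pmap => j; rewrite ffunE /= nU2.
have -> : \prod_(j in I) G j (vertex_word (merge U1 a1 a2) (U1 :|: U2) j) =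
    \prod_(j in I) G j (vertex_word a1 U1 j).
  apply: eq_bigr => j jI; congr (G j _); apply: eq_pmap_enum => W; rewrite ffunE inE /=.
  case: (W \in U1) => //=; case: (boolP (W \in U2)) => // W2.
  by rewrite (labels_tree_None W l2 t2) // inE jI.
have -> : \prod_(j in D :\ k :\: I) G j (vertex_word (merge U1 a1 a2) (U1 :|: U2) j) =
    \prod_(j in D :\ k :\: I) G j (vertex_word a2 U2 j).
  apply: eq_bigr => j; rewrite !inE => /and3P[jI jk jD]; congr (G j _).
  apply: eq_pmap_enum => W; rewrite ffunE inE /=; case: (boolP (W \in U1)) => W1 //=.
  rewrite (labels_tree_None W l1 t1) ?inE ?negb_or ?jk //.
  by case: ifP => // /nU2; rewrite W1.
have -> : pmap (fun W => merge U1 a1 a2 (W, k)) (enum ((U1 :|: U2) :\ V)) = vertex_word a2 U2 k.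
  apply: eq_pmap_enum => W; rewrite ffunE !inE /=.
  case: (boolP (W \in U1)) => W1 /=; last first.
    rewrite (_ : W != V) //; by apply: contraNneq W1 => ->.
  have -> : (W \in U2) = false by apply: contraTF W1 => /nU2 ->.
  case: eqP => //= WV; apply: (labels_None l1); rewrite W1 /=.
  apply/negP => kW; apply: WV; apply/set1P; rewrite -U1k inE W1.
  exact: kW.
(* [V] is the only edge of [U1] at [k], so the word there is a single letter and [letter_deriv b] is
   a Kronecker delta. *)
have -> : (merge U1 a1 a2 (V, k) == Some b)%:R = letter_deriv b (vertex_word a1 U1 k).
  rewrite ffunE /= V1.
  have := labelsP V k l1; rewrite V1 kV /=; case e: (a1 (V, k)) => [c|] // _.
  have : c \in vertex_word a1 U1 k.
    by rewrite mem_pmap; apply/mapP; exists V; rewrite ?mem_enum.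
  have := size_vertex_word k l1; rewrite U1k cards1.
  by case: (vertex_word a1 U1 k) => [|d []] // _; rewrite inE => /eqP ->.
have kDI : k \in D :\: I by rewrite inE kI.
rewrite big_setU1 //= [in RHS](big_setD1 k kDI) /=.
rewrite {1 3}/upd eqxx.
have -> : \prod_(j in I) upd G k (letter_deriv b) j (vertex_word a1 U1 j) =
    \prod_(j in I) G j (vertex_word a1 U1 j).
  by apply: eq_bigr => j jI; rewrite /upd; case: eqP => // jk; rewrite -jk jI in kI.
have -> : \prod_(j in D :\: I :\ k) upd G k g j (vertex_word a2 U2 j) =
    \prod_(j in D :\: I :\ k) G j (vertex_word a2 U2 j).
  by apply: eq_bigr => j; rewrite !inE /upd => /andP[/negbTE ->].
rewrite (_ : D :\: I :\ k = D :\ k :\: I); first by ring.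
by apply/setP => j; rewrite !inE andbCA.
Qed.


Lemma hypertree_degree U D k :
  hypertree U D -> k \in D -> (1 < #|D|)%N -> (0 < #|[set W in U | k \in W]|)%N.
Proof.
move=> /and3P[_ /forallP/(_ [set k]) H _] kD D1.
have /implyP/(_ _)/exists_inP[|V VU] := H.
  rewrite sub1set kD /=; apply/andP; split; first by apply/set0Pn; exists k; rewrite inE.
  by apply: contraTneq D1 => <-; rewrite cards1.
case/crossesP => y [z [yV /set1P yk _ _]].
by apply/card_gt0P; exists V; rewrite inE VU -yk.
Qed.

Lemma hypertree1 U k : hypertree U [set k] = (U == set0).
Proof.
apply/idP/eqP => [tU|->].
  apply/setP => V; rewrite inE; apply/negP => VU.
  have := subset_leq_card (hypertree_sub tU VU); rewrite cards1 leqNgt.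
  by rewrite (hypertree_gt1 tU VU).
apply/and3P; split.
- by apply/forall_inP => V; rewrite inE.
- apply/forallP => Y; apply/implyP => /and3P[]; rewrite subset1 => /orP[/eqP ->|/eqP ->].
    by rewrite eqxx.
  by rewrite eqxx.
- by rewrite /excess big_set0 cards1.
Qed.

Lemma tree_sum1 k G : tree_sum [set k] G = G k [::].
Proof.
rewrite /tree_sum (big_pred1 set0); last by move=> U; rewrite hypertree1.
rewrite /weight (big_pred1 [ffun=> None]); last first.
  move=> a; apply/forallP/eqP => [H|-> p]; last by rewrite ffunE inE.
  apply/ffunP => p; rewrite ffunE; have := H p; rewrite inE /=.
  by case: (a p).
by rewrite big_set0 mul1r big_set1 /vertex_word enum_set0.
Qed.

Lemma weight_eq0 D G U k : k \in D ->
  (forall u, size u = #|[set W in U | k \in W]| -> G k u = 0) -> weight D G U = 0.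
Proof.
move=> kD G0; apply: big1 => a aU.
by rewrite (big_setD1 k kD) /= G0 ?mul0r ?mulr0 // size_vertex_word.
Qed.

(** A constant at [k] is differentiated at least once because [k] lies on some edge; this matches
    the vanishing of cumulants with an entry 1. *)
Lemma tree_sum_nil D G k : k \in D -> (1 < #|D|)%N ->
  (forall u, (0 < size u)%N -> G k u = 0) -> tree_sum D G = 0.
Proof.
move=> kD D1 G0; apply: big1 => U tU; apply: (weight_eq0 kD) => u su.
by apply: G0; rewrite su (hypertree_degree tU).
Qed.

Lemma prod_upd D G k g (u : X -> seq L) : k \in D ->
  \prod_(j in D) upd G k g j (u j) = g (u k) * \prod_(j in D :\ k) G j (u j).
Proof.
move=> kD; rewrite (big_setD1 k kD) /= {1}/upd eqxx; congr (_ * _).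
by apply: eq_bigr => j; rewrite !inE /upd => /andP[/negbTE ->].
Qed.

Lemma tree_sum_linear D G k c g h : k \in D ->
  tree_sum D (upd G k (fun u => c * g u + h u)) =
  c * tree_sum D (upd G k g) + tree_sum D (upd G k h).
Proof.
move=> kD; rewrite /tree_sum mulr_sumr -big_split; apply: eq_bigr => U _ /=.
rewrite /weight mulr_sumr -big_split; apply: eq_bigr => a _ /=.
by rewrite !prod_upd //; ring.
Qed.

(** At most one edge at [k] differentiates the letter [b]. If none does, the term is [I = set0],
    with factor [x b]; otherwise [I] is what hangs behind that edge. *)
Lemma tree_sum_mul D G k b g : k \in D ->
  tree_sum D (upd G k (conv (letter_deriv b) g)) =
  \sum_(I : {set X} | I \subset D :\ k)
    tree_sum (k |: I) (upd G k (letter_deriv b)) * tree_sum (D :\: I) (upd G k g).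
Proof.
move=> kD.
pose w U V := \sum_(a | labels U a) (\prod_(W in U) S (edge_word a W)) *
    ((a (V, k) == Some b)%:R * g (pmap (fun W => a (W, k)) (enum (U :\ V))) *
     \prod_(j in D :\ k) G j (vertex_word a U j)).
have -> : tree_sum D (upd G k (conv (letter_deriv b) g)) =
    x b * tree_sum D (upd G k g) +
    \sum_(U | hypertree U D) \sum_(V in U | k \in V) w U V.
  rewrite /tree_sum mulr_sumr -big_split; apply: eq_bigr => U tU /=.
  rewrite exchange_big /= mulr_sumr -big_split; apply: eq_bigr => a aU /=.
  rewrite !prod_upd // conv_letter_deriv -mulr_sumr -mulr_suml big_mkcondr /=.
  rewrite [X in _ = _ + _ * (X * _)](eq_bigr (fun V => (a (V, k) == Some b)%:R *
    g (pmap (fun W => a (W, k)) (enum (U :\ V))))); last first.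
    move=> V VU; case: ifP => // kV.
    by rewrite (labels_None aU) ?kV ?andbF //= mul0r.
  by rewrite /vertex_word; ring.
rewrite hypertree_sum_cut // [RHS](bigD1 set0) ?sub0set //=; congr (_ + _).
  rewrite setU0 setD0 tree_sum1 /upd eqxx; congr (_ * _).
(* In the cut sum [I = set0] contributes nothing: a hypertree on [k] alone has no edge that could
   serve as [V]. *)
rewrite (bigD1 set0) ?sub0set //= setU0 big1 ?add0r; last first.
  move=> U1; rewrite hypertree1 => /eqP ->; apply: big1 => U2 _.
  rewrite big_pred0 // => V; apply/negP => /eqP/setP/(_ V).
  by rewrite !inE eqxx.
apply: eq_bigr => I /andP[ID I0].
rewrite /tree_sum mulr_suml; apply: eq_bigr => U1 t1.
rewrite mulr_sumr; apply: eq_bigr => U2 t2.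
(* If [k] does not lie on exactly one edge of [U1], both sides vanish: its degree is positive
   because [I] is nonempty, and a degree of two or more kills [letter_deriv b]. *)
have [V|none] := pickP [pred V | [set W in U1 | k \in W] == [set V]].
  move=> /= /eqP kV; rewrite (big_pred1 V) /w.
    exact: weight_merge.
  by move=> V' /=; rewrite kV (inj_eq set1_inj) eq_sym.
rewrite big_pred0 // (@weight_eq0 _ _ _ k) ?mul0r ?setU11 // => u.
have kI : k \notin I by apply/negP => /(subsetP ID); rewrite !inE eqxx.
have I1 : (1 < #|k |: I|)%N.
  by rewrite cardsU1 kI -cards_eq0 in I0 *; move: I0; case: #|I|.
have := hypertree_degree t1 (setU11 k I) I1; rewrite /upd eqxx.
case: u => [|c [|d u]] //= d0 d1; first by rewrite -d1 in d0.
by have /eqP/cards1P[V kV] := esym d1; have := none V; rewrite /= kV eqxx.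
Qed.

(** Single letters leave only the hypertree with the one edge [D]: in any other, some vertex lies on
    two edges and its letter is differentiated twice. *)
Lemma tree_sum_letters D (b : X -> L) : (1 < #|D|)%N ->
  tree_sum D (fun k => letter_deriv (b k)) = S (map b (enum D)).
Proof.
move=> D1; have D0 : D != set0 by rewrite -cards_eq0; case: #|D| D1.
rewrite /tree_sum (bigD1 [set D]) /=; last first.
  apply/and3P; split.
  - by apply/forall_inP => V /set1P ->; rewrite subxx.
  - apply/forallP => Y; apply/implyP => /and3P[YD Y0 YnD].
    apply/exists_inP; exists D; rewrite ?inE // /crosses (setIidPr YD) Y0 /=.
    by rewrite setD_eq0; apply: contra YnD => DY; rewrite eqEsubset YD.
  - by rewrite /excess big_set1.
rewrite [X in _ + X]big1 ?addr0; last first.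
  move=> U /andP[tU UnD].
  have /exists_inP[k kD k2] : [exists k in D, 1 < #|[set W in U | k \in W]|]%N.
    apply: contraR UnD; rewrite negb_exists_in => /forall_inP H.
    have [k kD] := set0Pn _ D0.
    have /card_gt0P[V] := hypertree_degree tU kD D1; rewrite inE => /andP[VU kV].
    (* Otherwise some edge [W] crosses [V], and a common vertex has degree at least two. *)
    have VD : V = D.
      apply/eqP; apply: contraT => VnD; have /and3P[_ /forallP/(_ V) c _] := tU.
      have /implyP/(_ _)/exists_inP[|W WU] := c.
        by rewrite (hypertree_sub tU VU) VnD andbT; apply/set0Pn; exists k.
      case/crossesP => y [z [yW yV zW zV]].
      have := H y (subsetP (hypertree_sub tU VU) y yV); rewrite -leqNgt.
      have WV : V != W by apply: contraNneq zV => ->.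
      have : [set V; W] \subset [set W in U | y \in W].
        by rewrite subUset !sub1set !inE VU WU yV yW.
      by move/subset_leq_card; rewrite cards2 WV => /leq_trans le /le.
    rewrite eq_sym eqEsubset sub1set -VD VU /=.
    apply/subsetP => W WU; rewrite inE.
    have /card_gt0P[y yW] := ltnW (hypertree_gt1 tU WU).
    have yD := subsetP (hypertree_sub tU WU) y yW.
    have := H y yD; rewrite -leqNgt => /card_le1_eqP H1; apply/eqP; apply: H1.
      by rewrite !inE VU VD.
    by rewrite !inE WU.
  by apply: (weight_eq0 kD); case=> [|c [|d u]] //= su; rewrite -su in k2.
pose a0 : labelling := [ffun p => if (p.1 == D) && (p.2 \in D) then Some (b p.2) else None].
have a0U : labels [set D] a0.
  apply/forallP => [[V k]]; rewrite ffunE inE /=; have [->|] //= := eqVneq V D.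
  by case: (k \in D).
have vw a k : k \in D -> labels [set D] a ->
    letter_deriv (b k) (vertex_word a [set D] k) = (a (D, k) == Some (b k))%:R.
  move=> kD aU; rewrite /vertex_word enum_set1 /=.
  by have := labelsP D k aU; rewrite inE eqxx kD; case: (a (D, k)).
rewrite /weight (bigD1 a0) //= [X in _ + X]big1 ?addr0 => [|a /andP[aU aa0]]; last first.
  have /exists_inP[k kD ak] : [exists k in D, a (D, k) != Some (b k)].
    apply: contraR aa0; rewrite negb_exists_in => /forall_inP H; apply/eqP/ffunP => [[V k]].
    rewrite ffunE /=; case: andP => [[/eqP -> kD]|VD].
      by apply/eqP; have := H k kD; rewrite negbK.
    apply: (labels_None aU); rewrite inE; apply/negP => /andP[VD' kV]; apply: VD.
    by split => //; rewrite -(eqP VD').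
  by rewrite [X in _ * X](big_setD1 k kD) /= vw // (negbTE ak) mul0r mulr0.
rewrite big_set1 [X in _ * X]big1 ?mulr1 => [|k kD]; last by rewrite vw // ffunE eqxx kD eqxx.
congr S; rewrite /edge_word; have : {subset enum D <= D} by move=> k; rewrite mem_enum.
elim: (enum D) => //= k s IH kD; rewrite ffunE /= eqxx kD ?mem_head //=.
by rewrite IH // => j js; apply: kD; rewrite inE js orbT.
Qed.

End LabelledTrees.

(** * Derivatives of polynomials *)

Section Derivatives.
Variables (F : numFieldType) (L : finType) (x : L -> F).
Implicit Types (P Q : qpolynom F L) (u w : seq L) (b c : L).

Lemma evalF_cat P Q : evalF x (P ++ Q) = evalF x P + evalF x Q.
Proof. exact: big_cat. Qed.

Lemma pderiv_cat b P Q : pderiv b (P ++ Q) = pderiv b P ++ pderiv b Q.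
Proof. by rewrite /pderiv map_cat flatten_cat. Qed.

Lemma pderivs_cat u P Q : pderivs u (P ++ Q) = pderivs u P ++ pderivs u Q.
Proof. by elim: u => //= b u ->; rewrite pderiv_cat. Qed.

Lemma pderivs_nil u : pderivs u ([::] : qpolynom F L) = [::].
Proof. by elim: u => //= b u ->. Qed.

Lemma pderivs_rcons u b P : pderivs (rcons u b) P = pderivs u (pderiv b P).
Proof. by rewrite /pderivs foldr_rcons. Qed.

Definition scaleq (r : F) P : qpolynom F L := [seq (r * t.1, t.2) | t <- P].

Lemma evalF_scale r P : evalF x (scaleq r P) = r * evalF x P.
Proof.
by rewrite /evalF big_map mulr_sumr; apply: eq_bigr => t _; rewrite mulrA.
Qed.

Lemma pderivs_scale r u P : pderivs u (scaleq r P) = scaleq r (pderivs u P).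
Proof.
elim: u => //= b u ->; elim: (pderivs u P) => //= t Q IH.
rewrite /pderiv /= -!/(pderiv _ _) /scaleq map_cat -/(scaleq _ _) IH; congr (_ ++ _).
by rewrite -map_comp.
Qed.

Lemma eval_pderivs_cons t u P :
  evalF x (pderivs u (t :: P)) =
  t.1 * evalF x (pderivs u [:: (1, t.2)]) + evalF x (pderivs u P).
Proof.
rewrite -cat1s pderivs_cat evalF_cat -evalF_scale -pderivs_scale /=.
by rewrite mulr1; case: t.
Qed.

Definition consq b P : qpolynom F L := [seq (t.1, b :: t.2) | t <- P].

(** Restricted to a single term because for several terms the two sides would list the derived terms
    in different orders; only the values agree. *)
Lemma pderiv_consq1 b c t :
  pderiv c (consq b [:: t]) = (if b == c then [:: t] else [::]) ++ consq b (pderiv c [:: t]).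
Proof.
case: t => r w; rewrite /pderiv /= !cats0 (iotaDl 1 0) filter_map /consq -map_comp.
by case: (b == c); rewrite /= -map_comp /drop_at /= ?drop0.
Qed.

(** The higher Leibniz rule: each differentiation acts on the letter [b] or on [P]. The induction
    removes the last letter of [u], the one [pderivs] applies first. *)
Lemma eval_pderivs_consq b u P :
  evalF x (pderivs u (consq b P)) =
  conv (letter_deriv x b) (fun v => evalF x (pderivs v P)) u.
Proof.
elim/last_ind: u P => [|u c IH] P.
  by rewrite /= /evalF big_map mulr_sumr; apply: eq_bigr => t _; rewrite big_cons; ring.
rewrite conv_rcons pderivs_rcons.
have -> : conv (fun v => letter_deriv x b (rcons v c)) (fun v => evalF x (pderivs v P)) u =
    (c == b)%:R * evalF x (pderivs u P).
  rewrite -(conv1 (fun v => evalF x (pderivs v P))) -convZl; apply: eq_conv => // v.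
  by rewrite /nil_indicator; case: v => [|d [|e v]] /=; rewrite ?mulr1 ?mulr0.
have E_cat v Q Q' : evalF x (pderivs v (Q ++ Q')) = evalF x (pderivs v Q) + evalF x (pderivs v Q').
  by rewrite pderivs_cat evalF_cat.
rewrite (eq_conv (G' := fun v => evalF x (pderivs v (pderiv c P))) (frefl _)); last first.
  by move=> v; rewrite pderivs_rcons.
elim: P => [|t P IHP].
  by rewrite /= pderivs_nil -/(consq b [::]) -IH /= pderivs_nil /evalF !big_nil mulr0 addr0.
rewrite -cat1s (_ : consq b ([:: t] ++ P) = consq b [:: t] ++ consq b P) //.
rewrite (pderiv_cat c (consq b [:: t])) (pderiv_cat c [:: t]) pderiv_consq1.
rewrite (E_cat u (_ ++ _) (pderiv c (consq b P))) (E_cat u [:: t]) IHP.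
rewrite (eq_conv (G' := fun v => evalF x (pderivs v (pderiv c [:: t])) +
  evalF x (pderivs v (pderiv c P))) (frefl _) (fun v => E_cat v _ _)).
rewrite E_cat IH convDr mulrDr.
rewrite (_ : evalF x (pderivs u (if b == c then [:: t] else [::])) =
  (c == b)%:R * evalF x (pderivs u [:: t])); first by ring.
by rewrite eq_sym; case: eqP; rewrite ?mul1r // mul0r pderivs_nil /evalF big_nil.
Qed.

(** The iterated derivatives of a monomial at [x], built by the recursion that [cum_mul] imposes;
    [eval_pderivs_word] identifies them with [pderivs]. *)
Fixpoint word_deriv (w : seq L) : seq L -> F :=
  if w is b :: v then conv (letter_deriv x b) (word_deriv v) else @nil_indicator L F.

Lemma eval_pderivs_word w u : evalF x (pderivs u [:: (1, w)]) = word_deriv w u.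
Proof.
elim: w u => [|b w IH] u /=; last first.
  rewrite -(eq_conv (frefl _) IH); exact: (eval_pderivs_consq b u [:: (1, w)]).
case/lastP: u => [|u c]; first by rewrite /evalF big_seq1 big_nil mulr1.
rewrite pderivs_rcons /pderiv /= pderivs_nil /evalF big_nil /nil_indicator.
by case: u.
Qed.

Lemma word_deriv1 b u : word_deriv [:: b] u = letter_deriv x b u.
Proof. by rewrite /= convC conv1. Qed.

End Derivatives.

(** * Limiting cumulants as sums over labelled hypertrees *)

Section TreeFormula.
Variables (F : numFieldType) (A : comAlgType F) (L X : finType) (q : L -> A).
Variable cum : seq A -> F.
Hypothesis cum_perm : forall s t, (0 < size s)%N -> perm_eq s t -> cum s = cum t.
Hypothesis cum_one : forall s, cum (1 :: s) = nil_indicator F s.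
Hypothesis cum_mul : forall a b s,
  cum (a * b :: s) = conv (fun u => cum (a :: u)) (fun u => cum (b :: u)) s.
Hypothesis cum_linear : forall c a b s,
  cum ((c *: a + b) :: s) = c * cum (a :: s) + cum (b :: s).

Let x (b : L) : F := cum [:: q b].
Let S (u : seq L) : F := cum (map q u).
Local Notation monomial w := (\prod_(b <- w) q b).

Lemma cum_monomial w : cum [:: monomial w] = word_deriv x w [::].
Proof.
elim: w => [|b w IH]; first by rewrite big_nil cum_one.
by rewrite big_cons cum_mul /= IH.
Qed.

Lemma cum_enum (f : X -> A) (D : {set X}) k : k \in D ->
  cum (map f (enum D)) = cum (f k :: map f (enum (D :\ k))).
Proof.
move=> kD; have kS : perm_eq (enum D) (k :: enum (D :\ k)).
  apply: uniq_perm; rewrite /= ?enum_uniq ?mem_enum ?inE ?eqxx // => j.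
  by rewrite inE !mem_enum !inE; case: eqP => [->|].
apply: cum_perm; last exact: (perm_map f kS).
by rewrite size_map -cardE; apply/card_gt0P; exists k.
Qed.

(** Both sides split a word [b :: v] at [k] into [[:: b]] on [k |: I] and [v] on [D :\: I], each
    with smaller surplus. [D] varies in the induction because the splitting changes the vertex
    set. *)
Lemma cum_words (D : {set X}) (w : X -> seq L) : D != set0 ->
  cum [seq monomial (w k) | k <- enum D] = tree_sum S D (fun k => word_deriv x (w k)).
Proof.
have [n] := ubnP (\sum_(k in D) (size (w k)).-1)%N; elim: n D w => // n IH D w wn D0.
have [D1|D1] := leqP #|D| 1.
  have /cards1P[k ->] : #|D| == 1%N by rewrite eqn_leq D1 card_gt0.
  by rewrite tree_sum1 enum_set1 /= cum_monomial.
have [/exists_inP[k kD wk]|] := boolP [exists k in D, size (w k) != 1%N]; last first.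
  rewrite negb_exists_in => /forall_inP w1.
  have [k0 k0D] := set0Pn _ D0.
  have := w1 k0 k0D; rewrite negbK; case w0: (w k0) => [|b0 [|]] // _.
  pose b k := head b0 (w k).
  have wb k : k \in D -> w k = [:: b k].
    by move/w1; rewrite negbK /b; case: (w k) => [|c []].
  rewrite (@eq_tree_sum _ _ _ S D _ (fun k => letter_deriv x (b k))); last first.
    by move=> k kD u; rewrite wb // word_deriv1.
  rewrite tree_sum_letters // /S -map_comp; congr cum.
  by apply/eq_in_map => k; rewrite mem_enum => kD; rewrite wb //= big_seq1.
rewrite (cum_enum _ kD).
(* Truncated subtraction gives the empty word surplus 0, like a single letter, so the constant
   monomial is treated apart. *)
case wkE: (w k) wk => [|b v] wk.
  rewrite big_nil cum_one (tree_sum_nil S kD D1); last first.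
    by move=> u u0; rewrite wkE; case: u u0.
  rewrite /nil_indicator /nilp size_map -cardE.
  by move: D1; rewrite (cardsD1 k) kD; case: #|_|.
have v0 : (0 < size v)%N by case: (v) wk.
rewrite big_cons cum_mul conv_set ?enum_uniq //.
rewrite (@eq_tree_sum _ _ _ S D _ (upd (fun j => word_deriv x (w j)) k
  (conv (letter_deriv x b) (word_deriv x v)))); last first.
  by move=> j jD u; rewrite /upd; case: eqP => // ->; rewrite wkE.
rewrite tree_sum_mul //.
have sizes (f : X -> nat) (E : {set X}) : E \subset D :\ k ->
    (\sum_(j in E) f j <= \sum_(j in D :\ k) f j)%N.
  by move=> ED; rewrite [X in (_ <= X)%N](big_setID E) /= (setIidPr ED) leq_addr.
rewrite (big_setD1 k kD) wkE /= in wn.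
apply: eq_big => [I|I ID].
  by apply/subsetP/subsetP => H j /H; rewrite mem_enum.
have {}ID : I \subset D :\ k.
  by apply/subsetP => j /(subsetP ID); rewrite mem_enum.
have kI : k \notin I by apply/negP => /(subsetP ID); rewrite !inE eqxx.
have words_upd v' (E : {set X}) : k \notin E ->
    [seq monomial (w j) | j <- enum E] = [seq monomial (upd w k v' j) | j <- enum E].
  move=> kE; apply/eq_in_map => j; rewrite mem_enum /upd => jE.
  by case: eqP => // jk; rewrite -jk jE in kE.
have deriv_upd v' j u : upd (fun j => word_deriv x (w j)) k (word_deriv x v') j u =
    word_deriv x (upd w k v' j) u by rewrite /upd; case: eqP.
have sizes_upd v' (E : {set X}) : k \notin E ->
    (\sum_(j in E) (size (upd w k v' j)).-1 = \sum_(j in E) (size (w j)).-1)%N.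
  move=> kE; apply: eq_bigr => j jE; rewrite /upd.
  by case: eqP => // jk; rewrite -jk jE in kE.
congr (_ * _).
- rewrite (@eq_tree_sum _ _ _ S _ _ (fun j => word_deriv x (upd w k [:: b] j))); last first.
    by move=> j _ u; rewrite -deriv_upd /upd; case: eqP => //; rewrite word_deriv1.
  rewrite -IH; first last.
  + by apply/set0Pn; exists k; rewrite setU11.
  + rewrite big_setU1 //= {1}/upd eqxx /= add0n sizes_upd //.
    by have := sizes (fun j => (size (w j)).-1) I ID; move: wn v0; lia.
  rewrite (cum_enum _ (setU11 k I)) /= {1}/upd eqxx big_seq1 setU1K // -words_upd //.
  congr (cum (_ :: map _ _)).
  rewrite /enum_mem -filter_predI; apply: eq_filter => j /=.
  by case: (boolP (j \in I)) => //= /(subsetP ID) ->.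
have kDI : k \in D :\: I by rewrite inE kI.
have subDI : D :\: I :\ k \subset D :\ k by apply/setSD/subsetDl.
have kDIk : k \notin D :\: I :\ k by rewrite !inE eqxx.
rewrite (eq_tree_sum S (fun j _ => deriv_upd v j)) -IH; first last.
- by apply/set0Pn; exists k.
- rewrite (big_setD1 k kDI) /= {1}/upd eqxx sizes_upd //.
  by have := sizes (fun j => (size (w j)).-1) _ subDI; move: wn v0; lia.
rewrite (cum_enum _ kDI) /= {1}/upd eqxx -words_upd //.
congr (cum (_ :: map _ _)).
rewrite /enum_mem -filter_predI; apply: eq_filter => j /=.
by rewrite !inE; case: (j \in I); rewrite ?andbF.
Qed.

Local Notation poly_family := (X -> qpolynom F L).

(** Expands all entries into monomials, one entry at a time. Each peeled term has its coefficient
    normalised to 1, to fit linearity in the form [c *: a + b]. *)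
Lemma multilinear_ind (Pr : poly_family -> Prop) :
  (forall P k, Pr (upd P k [::])) ->
  (forall P k t Q, Pr (upd P k [:: (1, t.2)]) -> Pr (upd P k Q) -> Pr (upd P k (t :: Q))) ->
  (forall P P', P =1 P' -> Pr P -> Pr P') ->
  (forall w, Pr (fun k => [:: (1, w k)])) -> forall P, Pr P.
Proof.
move=> Pr0 PrS Pr_ext PrW.
(* [r] holds the entries that may still be arbitrary polynomials; outside [r] an entry is one
   monomial with coefficient 1. *)
suff H (r : seq X) P : (forall k, k \notin r -> P k = [:: (1, (head (1, [::]) (P k)).2)]) -> Pr P.
  by move=> P; apply: (H (enum X)) => k; rewrite mem_enum.
elim: r P => [|k r IH] P Pk.
  by apply: (Pr_ext _ _ _ (PrW (fun k => (head (1, [::]) (P k)).2))) => k; rewrite -Pk.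
have PP : upd P k (P k) =1 P by move=> j; rewrite /upd; case: eqP => [->|].
apply: (Pr_ext _ _ PP); elim: (P k) => [|t Q IHQ] //; apply: PrS => //.
apply: IH => j jr; rewrite /upd; case: eqP => // jk.
by apply: Pk; rewrite inE negb_or jr andbT; apply/eqP.
Qed.

Lemma cum_polynomials (P : poly_family) : (0 < #|X|)%N ->
  cum [seq evalA q (P k) | k <- enum X] =
  tree_sum S [set: X] (fun k u => evalF x (pderivs u (P k))).
Proof.
move=> X0; move: P; have enumT : enum X = enum [set: X].
  by apply: eq_enum => k; rewrite !inE.
pose G (P : poly_family) := fun j u => evalF x (pderivs u (P j)).
have cum0 s : cum (0 :: s) = 0.
  by have := cum_linear (-1) 0 0 s; rewrite scaler0 addr0 mulN1r addNr.
have lhs P k Q : cum [seq evalA q (upd P k Q j) | j <- enum [set: X]] =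
    cum (evalA q Q :: [seq evalA q (P j) | j <- enum ([set: X] :\ k)]).
  rewrite (cum_enum _ (in_setT k)) {1}/upd eqxx; congr (cum (_ :: _)).
  apply/eq_in_map => j; rewrite mem_enum !inE andbT /upd => /negbTE -> //.
have rhs P k Q : tree_sum S [set: X] (G (upd P k Q)) =
    tree_sum S [set: X] (upd (G P) k (fun u => evalF x (pderivs u Q))).
  by apply: eq_tree_sum => j _ u; rewrite /G /upd; case: eqP.
rewrite enumT; apply: multilinear_ind => [P k|P k t Q|P P' PP' H|w].
- rewrite lhs rhs /evalA big_nil cum0.
  have := tree_sum_linear S (G P) (-1) (fun=> 0) (fun=> 0) (in_setT k).
  rewrite [X in _ = X + _]mulN1r [X in _ = X]addNr => <-.
  apply: eq_tree_sum => j _ u; rewrite /upd.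
  by case: eqP => // _; rewrite pderivs_nil /evalF big_nil; ring.
- rewrite !lhs !rhs => Ht HQ.
  have -> : evalA q (t :: Q) = t.1 *: evalA q [:: (1, t.2)] + evalA q Q.
    by rewrite /evalA big_cons big_seq1 scale1r.
  rewrite cum_linear Ht HQ -tree_sum_linear ?inE //.
  apply: eq_tree_sum => j _ u; rewrite /upd; case: eqP => // _.
  by rewrite [RHS]eval_pderivs_cons.
- rewrite -(eq_map (fun k => congr1 (evalA q) (PP' k))) H.
  by apply: eq_tree_sum => j _ u; rewrite PP'.
have -> : [seq evalA q [:: (1, w k)] | k <- enum [set: X]] =
    [seq monomial (w k) | k <- enum [set: X]].
  by apply: eq_map => k; rewrite /evalA big_seq1 scale1r.
rewrite cum_words; last by rewrite -card_gt0 cardsT.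
by apply: eq_tree_sum => j _ u; rewrite eval_pderivs_word.
Qed.

End TreeFormula.

(** * Minimal connected covers *)

(** A vertex set [Y] that no patch crosses separates the patches inside [Y] from the others;
    conversely a family [T] yields the cut [cover T], proper because patches are nonempty. As
    [1 < n], every singleton is a proper cut, hence its vertex is covered. *)
Lemma connected_cover_connects (n : nat) (U : {set {set 'I_n}}) :
  (1 < n)%N -> (forall V, V \in U -> V != set0) ->
  connected_cover U = connects U [set: 'I_n].
Proof.
move=> n1 U0; apply/andP/forallP => [[/eqP covU /forallP conn] Y|conn].
  apply/implyP => /and3P[_ Y0 YT]; apply: contraT.
  rewrite negb_exists_in => /forall_inP H.
  have dich V y : V \in U -> y \in V -> y \in Y -> V \subset Y.
    move=> VU yV yY; have := H V VU; rewrite /crosses negb_and !negbK setD_eq0.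
    by case/orP => // /eqP/setP/(_ y); rewrite !inE yV yY.
  have covered y : exists2 V, V \in U & y \in V.
    by apply/bigcupP; rewrite -/(cover U) covU inE.
  pose T := [set V in U | V \subset Y].
  apply: contraTT (conn T) => _; rewrite negb_imply negbK.
  apply/andP; split; last first.
    apply/pred0P => y /=; apply/negP => /andP[/bigcupP[V VT yV] /bigcupP[W WT yW]].
    move: VT WT; rewrite !inE => /andP[_ VY] /andP[nWT WU]; move: nWT; rewrite WU /=.
    by rewrite (dich W y) // (subsetP VY).
  apply/and3P; split; first by apply/subsetP => V; rewrite inE => /andP[].
    have [y yY] := set0Pn _ Y0; have [V VU yV] := covered y.
    by apply/set0Pn; exists V; rewrite inE VU (dich V y).
  apply: contraNneq YT => TU; rewrite -subTset; apply/subsetP => y _.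
  have [V VU yV] := covered y.
  by move: VU; rewrite -TU inE => /andP[_ /subsetP]; apply.
have cross_of Y : Y != set0 -> Y != setT -> exists2 V, V \in U & crosses V Y.
  move=> Y0 YT; have /implyP/(_ _)/exists_inP := conn Y; apply.
  by rewrite subsetT Y0.
split.
  rewrite -subTset; apply/subsetP => y _.
  have [||V VU /crossesP[z [_ [zV /set1P zy _ _]]]] := cross_of [set y].
  - by apply/set0Pn; exists y; rewrite inE.
  - by apply: contraTneq n1 => yT; rewrite -(card_ord n) -cardsT -yT cards1.
  by apply/bigcupP; exists V; rewrite // -zy.
apply/forallP => T; apply/implyP => /and3P[TU T0 TnU]; apply/negP => disj.
have in_cover (P : {set {set 'I_n}}) V y : V \in P -> y \in V -> y \in cover P.
  by move=> VP yV; apply/bigcupP; exists V.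
have no z : z \in cover T -> z \in cover (U :\: T) -> False.
  by move=> z1 z2; have /pred0P/(_ z) := disj; rewrite /= z1 z2.
have [||V VU /crossesP[y [z [yV yT zV zT]]]] := cross_of (cover T).
- have [V VT] := set0Pn _ T0; have [y yV] := set0Pn _ (U0 V (subsetP TU V VT)).
  by apply/set0Pn; exists y; apply: in_cover yV.
- have /set0Pn[V VUT] : U :\: T != set0.
    by rewrite setD_eq0; apply: contra TnU => UT; rewrite eqEsubset TU.
  have /set0Pn[y yV] : V != set0 by apply: U0; move: VUT; rewrite inE => /andP[].
  apply/eqP => covT; apply: (no y); first by rewrite covT inE.
  exact: in_cover yV.
have [VT|VT] := boolP (V \in T); first by rewrite (in_cover _ _ _ VT zV) in zT.
by apply: (no y yT); apply: in_cover yV; rewrite inE VT.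
Qed.

(** Each patch contributes its size minus 1 to the index, so the index is the excess. *)
Lemma min_cover_hypertree (n : nat) (U : {set {set 'I_n}}) :
  (1 < n)%N -> min_cover U = hypertree U [set: 'I_n].
Proof.
move=> n1; rewrite /min_cover /hypertree.
have -> : [forall V in U, (V \subset [set: 'I_n]) && (1 < #|V|)%N] =
    [forall V in U, (1 < #|V|)%N].
  by apply: eq_forallb => V; rewrite subsetT.
case: (boolP [forall V in U, (1 < #|V|)%N]) => [/forall_inP U1|_]; last by rewrite !andbF.
rewrite andbT /= connected_cover_connects //; last first.
  by move=> V /U1; rewrite -card_gt0; case: #|V|.
congr (_ && _); rewrite /cover_index.
have -> : (\sum_(V in U) #|V| = excess U + #|U|)%N.
  by rewrite -sum1_card /excess -big_split; apply: eq_bigr => V /U1 /=; lia.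
by rewrite cardsT card_ord; apply/eqP/eqP; lia.
Qed.

From mathcomp Require Import boolp classical_sets fsbigop topology normedtype.
Import numFieldNormedType.Exports.
Local Open Scope classical_set_scope.

(** * Limits of scaled cumulants *)

Lemma conv_cvg (F : numFieldType) (T : eqType) (f g : seq T -> F -> F) (a b : seq T -> F) s :
  (forall u, subseq u s -> f u @ +oo --> a u) ->
  (forall u, subseq u s -> g u @ +oo --> b u) ->
  (fun l => conv (f^~ l) (g^~ l) s) @ +oo --> conv a b s.
Proof.
elim: s f g a b => [|y s IH] f g a b fa gb /=.
  by apply: cvgM; [apply: fa|apply: gb].
have sub u : subseq u s -> subseq u (y :: s).
  by move=> us; apply: subseq_trans us (subseq_cons _ _).
have sub' u : subseq u s -> subseq (y :: u) (y :: s) by rewrite /= eqxx.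
apply: cvgD.
- apply: (IH (fun u => f (y :: u)) g (fun u => a (y :: u))) => u us.
    exact: fa (sub' _ us).
  exact: gb (sub _ us).
- apply: (IH f (fun u => g (y :: u)) a (fun u => b (y :: u))) => u us.
    exact: fa (sub _ us).
  exact: gb (sub' _ us).
Qed.

Lemma near_pos_cvg (F : numFieldType) (f g : F -> F) (v : F) :
  (forall l, 0 < l -> f l = g l) -> g @ +oo --> v -> f @ +oo --> v.
Proof.
move=> fg; apply: cvg_trans; apply: near_eq_cvg.
near=> l; rewrite fg //; near: l; exact: nbhs_pinfty_gt.
Unshelve. all: by end_near. Qed.

Lemma inv_cvg_pinfty (F : numFieldType) : (fun l : F => l^-1) @ +oo --> (0 : F).
Proof.
apply/cvgrPdist_lt => e e0; near=> l.
have l0 : 0 < l by near: l; apply: nbhs_pinfty_gt.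
rewrite sub0r normrN gtr0_norm ?invr_gt0 // -[e]invrK ltf_pV2 ?posrE ?invr_gt0 //.
near: l; apply: nbhs_pinfty_gt; by rewrite gtr0_real // invr_gt0.
Unshelve. all: by end_near. Qed.

Section ScaledCumulants.
Variables (F : numFieldType) (alpha : choiceType) (A : comAlgType F) (q : alpha -> A).
Variables (mom : F -> A -> F) (kappa : F -> seq A -> F).
Hypothesis mom_linear : forall l : F, 0 < l -> forall (c : F) (x y : A),
  mom l (c *: x + y) = c * mom l x + mom l y.
Hypothesis mom1 : forall l : F, 0 < l -> mom l 1 = 1.
Hypothesis mc : moment_cumulant mom kappa.
Hypothesis letters_cvg : forall s : seq alpha, (0 < size s)%N ->
  cvg (scaled_cum kappa (map q s) @ +oo).
Local Notation sc := (scaled_cum kappa).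

Let mc' l (l0 : 0 < l) (s : seq A) (s0 : (0 < size s)%N) :
  mom l (\prod_(o <- s) o) =
  partition_sum (fun V => kappa l (listed V)) [set: 'I_(size s)]%SET.
Proof. exact: mc. Qed.

Lemma scaled_cum_perm s t : perm_eq s t -> forall l, 0 < l -> sc s l = sc t l.
Proof.
move=> st l l0; rewrite /scaled_cum (perm_size st); congr (_ * _).
exact: (kappa_perm (mom1 l0) (mc' l0)).
Qed.

Lemma scaled_cum_one s l : 0 < l -> sc (1 :: s) l = nil_indicator F s.
Proof.
move=> l0; rewrite /scaled_cum (kappa_one (mom1 l0) (mc' l0)) /=.
by case: s => [|y s]; rewrite /nil_indicator /= ?mul1r ?mulr0.
Qed.

Lemma scaled_cum_linear c x y s l : 0 < l ->
  sc ((c *: x + y) :: s) l = c * sc (x :: s) l + sc (y :: s) l.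
Proof.
by move=> l0; rewrite /scaled_cum (kappa_linear (mom_linear l0) (mom1 l0) (mc' l0)) /=; ring.
Qed.

(** The term with [x] and [y] as separate arguments has one entry more, so its scaling carries one
    power of [l] too many, whence [l^-1]; in the convolution the powers match. *)
Lemma scaled_cum_mul x y s l : 0 < l ->
  sc (x * y :: s) l = l^-1 * sc [:: x, y & s] l
    + conv (fun u => sc (x :: u) l) (fun u => sc (y :: u) l) s.
Proof.
move=> l0; rewrite /scaled_cum (kappa_mul (mom1 l0) (mc' l0)) /=.
by rewrite conv_expr exprS; field; rewrite gt_eqF.
Qed.

Lemma scaled_cum1 x l : 0 < l -> sc [:: x] l = mom l x.
Proof.
by move=> l0; rewrite /scaled_cum (kappa1 (mom1 l0) (mc' l0)) mul1r.
Qed.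

Lemma scaled_cum0 s l : 0 < l -> sc (0 :: s) l = 0.
Proof.
move=> l0; have := scaled_cum_linear (-1) 0 0 s l0.
by rewrite scaler0 addr0 mulN1r addNr.
Qed.

Definition word (w : seq alpha) : A := \prod_(a <- w) q a.

(** Induction on the surplus: a word of length at least two is split by the product rule into pieces
    of smaller surplus. The term divided by [l] is among them, and it must be known to converge
    before it can vanish. *)
Lemma words_cvg (ws : seq (seq alpha)) : (0 < size ws)%N ->
  cvg (sc (map word ws) @ +oo).
Proof.
have [n] := ubnP (\sum_(w <- ws) (size w).-1); elim: n ws => // n IH ws wsn ws0.
have [|] := boolP (has (fun w => size w != 1%N) ws); last first.
  rewrite -all_predC => /allP /= ws1.
  pose a := flatten ws; suff -> : map word ws = map q a.
    apply: letters_cvg; rewrite /a; case: (ws) ws0 ws1 => //= w ws' _ /(_ w).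
    by rewrite mem_head negbK size_cat => /(_ isT)/eqP ->.
  rewrite /a; elim: (ws) ws1 => //= w ws' IHws ws1; rewrite map_cat -IHws; last first.
    by move=> v vw; apply: ws1; rewrite inE vw orbT.
  have := ws1 w (mem_head _ _); rewrite negbK; case: w {ws1} => [|b [|c w]] //= _.
  by rewrite /word big_seq1.
case/hasP => w wws sw; have pw := perm_to_rem wws.
move: (rem w ws) pw => ws' pw.
have pmap := perm_map word pw.
(* A word of length other than one is moved to the front, where the rules for 1 and for products
   apply. *)
suff H : exists v : F, sc (map word (w :: ws')) @ +oo --> v.
  by case: H => v Hv; apply/cvg_ex; exists v; apply: near_pos_cvg Hv => l; apply: scaled_cum_perm.
have {}wsn : (\sum_(v <- w :: ws') (size v).-1 < n.+1)%N by rewrite -(perm_big _ pw).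
rewrite big_cons in wsn.
case: w sw wsn {wws pw pmap} => [|b [|c w]] // _ wsn.
  exists (nil_indicator F (map word ws')); rewrite /= /word big_nil.
  apply: (@near_pos_cvg _ _ (fun=> nil_indicator F (map word ws'))).
    by move=> l; exact: scaled_cum_one.
  exact: cvg_cst.
have sub_le u : subseq u ws' -> (\sum_(v <- u) (size v).-1 <= \sum_(v <- ws') (size v).-1)%N.
  case/subseqP => m _ ->; elim: m {wsn} (ws') => [|[] m IHm] [|v s] //=; rewrite ?big_nil // !big_cons.
    by rewrite leq_add2l.
  by apply: leq_trans (IHm s) _; apply: leq_addl.
have prod_word : word [:: b, c & w] = q b * word (c :: w) by rewrite /word big_cons.
have qw : q b = word [:: b] by rewrite /word big_seq1.
have /cvg_ex[v1 H1] : cvg (sc (map word [:: [:: b], c :: w & ws']) @ +oo).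
  by apply: IH => //; rewrite !big_cons /= add0n.
exists (conv (fun u => lim (sc (q b :: map word u) @ +oo))
             (fun u => lim (sc (word (c :: w) :: map word u) @ +oo)) ws').
rewrite /= prod_word; apply: (@near_pos_cvg _ _ (fun l => l^-1 * sc [:: q b, word (c :: w) & map word ws'] l
    + conv (fun u => sc (q b :: u) l) (fun u => sc (word (c :: w) :: u) l) (map word ws'))).
  by move=> l; exact: scaled_cum_mul.
rewrite -[conv _ _ _]add0r -[0](mul0r v1); apply: cvgD.
  apply: cvgM; first exact: inv_cvg_pinfty.
  by rewrite qw.
under eq_cvg do rewrite conv_map.
apply: (conv_cvg (f := fun u l => sc (q b :: map word u) l)
  (g := fun u l => sc (word (c :: w) :: map word u) l)) => u /sub_le ule.
  rewrite qw; apply: (IH ([:: b] :: u)) => //; rewrite big_cons /= add0n.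
  by move: ule wsn => /=; lia.
apply: (IH ((c :: w) :: u)) => //; rewrite big_cons /=.
by move: ule wsn => /=; lia.
Qed.

Hypothesis generated : forall o : A, exists P : qpolynom F alpha, o = evalA q P.

(** Entries are expanded from the left, and each resulting word is moved into the tail [ws], so that
    induction on [s] applies. *)
Lemma scaled_cum_cvg (s : seq A) : (0 < size s)%N -> cvg (sc s @ +oo).
Proof.
suff H ws : (0 < size (s ++ map word ws))%N -> cvg (sc (s ++ map word ws) @ +oo).
  by move=> s0; have := H [::]; rewrite cats0; apply.
elim: s ws => [|x s IH] ws /=; first by rewrite size_map; exact: words_cvg.
move=> _; have [P ->] := generated x; rewrite /evalA; elim: P => [|[c w] P IHP].
  rewrite big_nil; apply/cvg_ex; exists 0; apply: (@near_pos_cvg _ _ (fun=> 0)).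
    by move=> l; apply: scaled_cum0.
  exact: cvg_cst.
rewrite big_cons -/(word w) /=.
have : cvg (sc (word w :: s ++ map word ws) @ +oo).
  have /(IH (w :: ws))/cvg_ex[v Hv] : (0 < size (s ++ map word (w :: ws)))%N.
    by rewrite size_cat /= addnS.
  apply/cvg_ex; exists v; apply: near_pos_cvg Hv => l; apply: scaled_cum_perm.
  by rewrite perm_sym -cat_rcons -cat1s catA perm_cat2r -cats1 perm_catC.
move/cvg_ex => [v Hv]; move/cvg_ex: IHP => [v' Hv'].
apply/cvg_ex; exists (c * v + v').
apply: near_pos_cvg; first by move=> l; apply: scaled_cum_linear.
by apply: cvgD => //; apply: cvgMr.
Qed.

Definition limit_cum (s : seq A) : F := lim (sc s @ +oo).

Let limit_cumP s : (0 < size s)%N -> sc s @ +oo --> limit_cum s.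
Proof. exact: scaled_cum_cvg. Qed.

Let limit_cum_eq s f v : (0 < size s)%N -> (forall l, 0 < l -> sc s l = f l) ->
  f @ +oo --> v -> limit_cum s = v.
Proof.
by move=> s0 sf fv; apply: cvg_lim; [exact: norm_hausdorff | exact: near_pos_cvg fv].
Qed.

Lemma limit_cum_perm s t : (0 < size s)%N -> perm_eq s t -> limit_cum s = limit_cum t.
Proof.
move=> s0 st; apply: (limit_cum_eq s0 (scaled_cum_perm st)).
by apply: limit_cumP; rewrite -(perm_size st).
Qed.

Lemma limit_cum_one s : limit_cum (1 :: s) = nil_indicator F s.
Proof.
apply: (@limit_cum_eq _ (fun=> nil_indicator F s)) => // [l|]; last exact: cvg_cst.
exact: scaled_cum_one.
Qed.

Lemma limit_cum_linear c x y s :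
  limit_cum ((c *: x + y) :: s) = c * limit_cum (x :: s) + limit_cum (y :: s).
Proof.
apply: limit_cum_eq; [by []|by move=> l; apply: scaled_cum_linear|].
by apply: cvgD; [apply: cvgMr|]; apply: limit_cumP.
Qed.

Lemma limit_cum_mul x y s :
  limit_cum (x * y :: s) =
  conv (fun u => limit_cum (x :: u)) (fun u => limit_cum (y :: u)) s.
Proof.
apply: limit_cum_eq; [by []|by move=> l; apply: scaled_cum_mul|].
rewrite -[conv _ _ _]add0r -[0](mul0r (limit_cum [:: x, y & s])); apply: cvgD.
  by apply: cvgM; [exact: inv_cvg_pinfty | exact: limit_cumP].
by apply: (conv_cvg (f := fun u l => sc (x :: u) l) (g := fun u l => sc (y :: u) l))
  => u _; apply: limit_cumP.
Qed.

Lemma moment_cvg x : mom^~ x @ +oo --> limit_cum [:: x].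
Proof.
apply: (@near_pos_cvg _ _ (sc [:: x])); last exact: limit_cumP.
by move=> l /(scaled_cum1 x).
Qed.

End ScaledCumulants.

(** * Reduction to finitely many letters *)

Lemma pmap_omap (T B C : Type) (g : B -> C) (f : T -> option B) (s : seq T) :
  pmap (fun y => omap g (f y)) s = map g (pmap f s).
Proof. by elim: s => //= y s ->; case: (f y). Qed.

Section Letters.
Variables (F : numFieldType) (alpha : choiceType).

(** Differentiation creates no new letters, so [c] stays absent until its turn in [bs], and then
    every term is lost. This bounds the families that contribute when [alpha] is infinite. *)
Lemma pderivs_absent (c : alpha) bs (P : qpolynom F alpha) :
  c \in bs -> all (fun t => c \notin t.2) P -> pderivs bs P = [::].
Proof.
have keep b (Q : qpolynom F alpha) : all (fun t => c \notin t.2) Q ->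
    all (fun t => c \notin t.2) (pderiv b Q).
  elim: Q => //= t Q IH /andP[ct /IH {}IH]; rewrite /pderiv /= all_cat.
  apply/andP; split; last exact: IH.
  apply/allP => _ /mapP[i _ ->] /=; apply: contra ct; rewrite mem_cat.
  by case/orP => [/mem_take|/mem_drop].
have kill (Q : qpolynom F alpha) : all (fun t => c \notin t.2) Q -> pderiv c Q = [::].
  elim: Q => //= t Q IH /andP[ct /IH {}IH]; rewrite /pderiv /= -/(pderiv c Q) IH cats0.
  rewrite (_ : [seq i <- _ | _] = [::]) //; apply/eqP.
  rewrite -[_ == _]negbK -has_filter; apply/hasPn => i; rewrite mem_iota /= add0n => it.
  by apply: contraNneq ct => <-; apply: mem_nth.
move=> cbs cP; have keeps us : all (fun t => c \notin t.2) (pderivs us P).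
  by elim: us => //= b us IH; apply: keep.
elim: bs cbs => //= b bs IH; rewrite inE => /predU1P[<-|/IH ->] //.
exact: kill.
Qed.

Section Inclusion.
Variables (L : choiceType) (i : L -> alpha).
Hypothesis inj_i : injective i.

Definition map_letters (P : qpolynom F L) : qpolynom F alpha :=
  [seq (t.1, map i t.2) | t <- P].

Lemma pderivs_map_letters bs (P : qpolynom F L) :
  pderivs (map i bs) (map_letters P) = map_letters (pderivs bs P).
Proof.
elim: bs => //= b bs ->; elim: (pderivs bs P) => //= t Q IH.
rewrite /pderiv /= -!/(pderiv _ _) /map_letters map_cat -/(map_letters _) IH.
congr (_ ++ _); rewrite -map_comp size_map.
rewrite (@eq_in_filter _ _ (fun k => nth b t.2 k == b)); last first.
  by move=> k; rewrite mem_iota /= add0n => kt; rewrite (nth_map b) // (inj_eq inj_i).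
by apply: eq_map => k; rewrite /drop_at /= map_cat map_take map_drop.
Qed.

Lemma evalF_map_letters (x : alpha -> F) (P : qpolynom F L) :
  evalF x (map_letters P) = evalF (x \o i) P.
Proof. by rewrite /evalF big_map; apply: eq_bigr => t _; rewrite big_map. Qed.

Lemma evalA_map_letters (A : lalgType F) (q : alpha -> A) (P : qpolynom F L) :
  evalA q (map_letters P) = evalA (q \o i) P.
Proof. by rewrite /evalA big_map; apply: eq_bigr => t _; rewrite big_map. Qed.

End Inclusion.

Lemma sum_index_families (n : nat) (U : {set {set 'I_n}}) (r : seq alpha)
    (S : seq alpha -> F) (x : alpha -> F) (P : 'I_n -> qpolynom F (seq_sub r)) :
  \sum_(a \in index_families (alpha:=alpha) U)
    ((\prod_(V | V \in U) S (block_indices a V)) *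
     \prod_(k < n) evalF x (pderivs (point_indices a U k) (map_letters val (P k)))) =
  weight (fun u => S (map val u)) [set: 'I_n]%SET
    (fun k u => evalF (x \o val) (pderivs u (P k))) U.
Proof.
pose incl (a : {ffun {set 'I_n} * 'I_n -> option (seq_sub r)}) :
    {ffun {set 'I_n} * 'I_n -> option alpha} := [ffun p => omap val (a p)].
have incl_inj : injective incl.
  move=> a a' e; apply/ffunP => p; have := congr1 (fun h : {ffun _ -> _} => h p) e.
  by rewrite /= !ffunE; case: (a p) (a' p) => [y|] [z|] //= [] /val_inj ->.
rewrite (fsbigE (map incl (enum (labels (L := seq_sub r) U)))); first last.
(* A family that uses a letter outside [r] differentiates some polynomial by an absent letter and
   contributes 0, so the listed families contain the support. *)
- move=> a aU ar.
  have [/existsP[[V k] /= Vk]|none] :=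
      boolP [exists p : {set 'I_n} * 'I_n, if a p is Some c then c \notin r else false].
    case e: (a (V, k)) Vk => [c|//] cr.
    rewrite (bigD1 k) //= (_ : pderivs _ _ = [::]) /evalF ?big_nil ?mul0r ?mulr0 //.
    apply: (@pderivs_absent c).
      have := aU (V, k); rewrite e /= => /esym/andP[VU _].
      by rewrite mem_pmap; apply/mapP; exists V; rewrite ?mem_enum.
    apply/allP => _ /mapP[t _ ->] /=; apply: contra cr => /mapP[d _ ->].
    exact: valP.
  case/negP: ar; apply/mapP.
  pose a' : {ffun {set 'I_n} * 'I_n -> option (seq_sub r)} := [ffun p => obind insub (a p)].
  have aa' : a = incl a'.
    apply/ffunP => p; rewrite !ffunE.
    move: none; rewrite negb_exists => /forallP/(_ p); case: (a p) => [c|] //=.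
    by rewrite negbK => cr; rewrite insubT.
  exists a' => //; rewrite mem_enum; apply/forallP => p; apply/eqP.
  by rewrite -(aU p) aa' !ffunE; case: (obind _ _).
- move=> b /= /mapP[a]; rewrite mem_enum => /forallP aU -> p.
  by rewrite -(eqP (aU p)) ffunE; case: (a p).
- by rewrite map_inj_uniq ?enum_uniq.
rewrite big_map big_enum_cond /=; apply: eq_big => [a|a _].
  apply/andP/idP => [[]//|aU]; split=> //; apply: mem_set => p.
  by have /forallP/(_ p)/eqP <- := aU; rewrite ffunE; case: (a p).
congr (_ * _).
  apply: eq_bigr => V _; congr S; rewrite -pmap_omap; apply: eq_pmap => k.
  by rewrite ffunE.
apply: eq_big => [k|k _]; first by rewrite inE.
rewrite -(evalF_map_letters val x) -(pderivs_map_letters (i := val) val_inj).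
congr (evalF _ (pderivs _ _)); rewrite -pmap_omap; apply: eq_pmap => V.
by rewrite ffunE.
Qed.

Lemma map_letters_onto (r : seq alpha) (P : qpolynom F alpha) :
  all (fun t => all (fun c => c \in r) t.2) P ->
  exists Q : qpolynom F (seq_sub r), map_letters val Q = P.
Proof.
move=> /allP rP; exists [seq (t.1, pmap insub t.2) | t <- P].
rewrite /map_letters -map_comp -[RHS]map_id; apply/eq_in_map => [[c w]] /rP /= /allP wr.
congr pair; elim: w wr => //= b w IH wr.
rewrite insubT ?wr ?mem_head //= => br; rewrite IH // => d dw.
by apply: wr; rewrite inE dw orbT.
Qed.

End Letters.

Theorem theorem1 (F : numFieldType) (alpha : choiceType) (A : comAlgType F)
  (q : alpha -> A)
  (hgen : forall o : A, exists P : qpolynom F alpha, o = evalA q P)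
  (mom : F -> A -> F)
  (hlin : forall l : F, 0 < l -> forall (c : F) (x y : A),
     mom l (c *: x + y) = c * mom l x + mom l y)
  (hnorm : forall l : F, 0 < l -> mom l 1 = 1)
  (kappa : F -> seq A -> F)
  (hcum : moment_cumulant mom kappa)
  (hS : forall s : seq alpha, (0 < size s)%N ->
     cvg (scaled_cum kappa (map q s) @ +oo)) :
  let S (s : seq alpha) : F := lim (scaled_cum kappa (map q s) @ +oo) in
  let qbar (a : alpha) : F := lim (mom^~ (q a) @ +oo) in
  (forall s : seq A, (0 < size s)%N -> cvg (scaled_cum kappa s @ +oo)) /\
  (forall o : A, cvg (mom^~ o @ +oo)) /\
  (forall P : qpolynom F alpha, lim (mom^~ (evalA q P) @ +oo) = evalF qbar P) /\
  (forall (n : nat) (Ps : n.-tuple (qpolynom F alpha)), (2 <= n)%N ->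
     lim (scaled_cum kappa [seq evalA q P | P <- Ps] @ +oo) =
     \sum_(U : {set {set 'I_n}} | min_cover U)
       \sum_(a \in index_families (alpha:=alpha) U)
         ((\prod_(V | V \in U) S (block_indices a V)) *
          \prod_(k < n) evalF qbar (pderivs (point_indices a U k) (tnth Ps k)))).
Proof.
move=> S qbar.
have cum_perm := limit_cum_perm hlin hnorm hcum hS hgen.
have cum_one := limit_cum_one hnorm hcum.
have cum_mul := limit_cum_mul hlin hnorm hcum hS hgen.
have cum_linear := limit_cum_linear hlin hnorm hcum hS hgen.
have mom_cvg := moment_cvg hlin hnorm hcum hS hgen.
have lim_mom o : lim (mom^~ o @ +oo) = limit_cum kappa [:: o].
  by apply: cvg_lim; [exact: norm_hausdorff|exact: mom_cvg].
split; first exact: scaled_cum_cvg hlin hnorm hcum hS hgen.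
split; first by move=> o; apply/cvg_ex; exists (limit_cum kappa [:: o]).
split.
  move=> P; rewrite lim_mom; elim: P => [|t P IH].
    have := cum_linear (-1) 0 0 [::]; rewrite scaler0 addr0 mulN1r addNr.
    by rewrite /evalA /evalF !big_nil.
  rewrite /evalA /evalF !big_cons cum_linear; congr (_ * _ + _); last exact: IH.
  (* With an empty tail the convolution in [cum_mul] is a plain product, so the limiting expectation
     is multiplicative. *)
  elim: (t.2) => [|b w IHw]; first by rewrite !big_nil cum_one.
  by rewrite !big_cons cum_mul /= IHw /qbar lim_mom.
move=> n Ps n2.
(* The letters that occur in [Ps]: over the finite type [seq_sub r] the tree formula applies, and
   [sum_index_families] returns to [alpha]. *)
pose r := flatten [seq flatten (map snd P) | P <- Ps].
have onto k : exists Q : qpolynom F (seq_sub r), map_letters val Q = tnth Ps k.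
  apply: map_letters_onto; apply/allP => t tP; apply/allP => c ct.
  apply/flattenP; exists (flatten (map snd (tnth Ps k))).
    exact: (map_f (fun P : qpolynom F alpha => flatten (map snd P))) (mem_tnth k Ps).
  by apply/flattenP; exists t.2 => //; apply: map_f.
have [Q HQ] := choice onto.
rewrite (_ : [seq evalA q P | P <- Ps] = [seq evalA (q \o val) (Q k) | k <- enum 'I_n]); last first.
  rewrite -[in LHS](map_tnth_enum Ps) -map_comp; apply: eq_map => k /=.
  by rewrite -(evalA_map_letters val q) HQ.
rewrite -/(limit_cum kappa _) cum_polynomials //; last by rewrite card_ord ltnW.
rewrite /tree_sum; apply: eq_big => [U|U _]; first by rewrite min_cover_hypertree.
have -> : tnth Ps = (fun k => map_letters val (Q k)) by apply: funext => k; rewrite HQ.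
rewrite sum_index_families; apply: eq_bigr => a _; congr (_ * _).
  by apply: eq_bigr => V _; rewrite /S /limit_cum -map_comp.
by apply: eq_bigr => k _; rewrite /qbar; congr (evalF _ _); apply: funext => b /=; rewrite lim_mom.
Qed.
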